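(* Let $K$ be a finitely presented $\mathbb{Z}$-group and let $n\in\{2,3,4\}$. Then $K$ has either finitely many or uncountably many subgroups of index $n$. (Equivalently: if $K$ contains infinitely many subgroups of index $n$, then $K$ contains uncountably many subgroups of index $n$.)
   Context: A finitely presented $\mathbb{Z}$-group is a group $K$ of the form $K=\ker\chi$, where $G$ is a finitely presented group and $\chi: G\to\mathbb{Z}$ is an epimorphism. ($K$ itself need not be finitely generated.) Subgroups are counted as subgroups, not up to conjugacy. *)

(* Defs.v *)
From HB Require Import structures.
From mathcomp Require Import all_boot all_algebra.
From mathcomp Require Import boolp classical_sets functions cardinality.

Set Implicit Arguments.
Unset Strict Implicit.
Unset Printing Implicit Defensive.

Local Open Scope quotient_scope.
Local Open Scope classical_set_scope.
Local Open Scope group_scope.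

Section FreeGroup.
Variable X : choiceType.

(* [(x, true)] stands for the generator x, and [(x, false)] for its inverse. *)
Definition word : Type := seq (X * bool).

Inductive free_eq : word -> word -> Prop :=
| free_eq_refl u : free_eq u u
| free_eq_sym u v : free_eq u v -> free_eq v u
| free_eq_trans u v w : free_eq u v -> free_eq v w -> free_eq u w
| free_eq_cancel u v x b : free_eq (u ++ (x, b) :: (x, ~~ b) :: v) (u ++ v).

Definition word_inv (u : word) : word := rev [seq (p.1, ~~ p.2) | p <- u].

Lemma free_eq_catl (w u v : word) : free_eq u v -> free_eq (w ++ u) (w ++ v).
Proof.
elim=> {u v} [u|u v _ h|u v t _ h1 _ h2|u v x b].
- exact: free_eq_refl.
- exact: free_eq_sym.
- exact: free_eq_trans h1 h2.
- by rewrite !catA; apply: free_eq_cancel.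
Qed.

Lemma free_eq_catr (w u v : word) : free_eq u v -> free_eq (u ++ w) (v ++ w).
Proof.
elim=> {u v} [u|u v _ h|u v t _ h1 _ h2|u v x b].
- exact: free_eq_refl.
- exact: free_eq_sym.
- exact: free_eq_trans h1 h2.
- by rewrite -!catA /=; apply: free_eq_cancel.
Qed.

Lemma word_inv_cat (u v : word) : word_inv (u ++ v) = word_inv v ++ word_inv u.
Proof. by rewrite /word_inv map_cat rev_cat. Qed.

Lemma word_inv_cons p (u : word) :
  word_inv (p :: u) = word_inv u ++ [:: (p.1, ~~ p.2)].
Proof. by rewrite -cat1s word_inv_cat. Qed.

Lemma word_invK : involutive word_inv.
Proof.
move=> u; rewrite /word_inv map_rev revK -map_comp -[RHS]map_id.
by apply: eq_map => -[x b] /=; rewrite negbK.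
Qed.

Lemma free_eq_inv (u v : word) : free_eq u v -> free_eq (word_inv u) (word_inv v).
Proof.
elim=> {u v} [u|u v _ h|u v t _ h1 _ h2|u v x b].
- exact: free_eq_refl.
- exact: free_eq_sym.
- exact: free_eq_trans h1 h2.
- rewrite !word_inv_cat !word_inv_cons -!catA /= negbK.
  exact: free_eq_cancel.
Qed.

Lemma free_eq_mulV (u : word) : free_eq (u ++ word_inv u) [::].
Proof.
elim: u => [|[x b] u IHu]; first exact: free_eq_refl.
rewrite word_inv_cons.
have /(free_eq_catr [:: (x, ~~ b)]) /(free_eq_catl [:: (x, b)]) := IHu.
rewrite -catA /= => /free_eq_trans; apply.
exact: (free_eq_cancel [::] [::]).
Qed.

Let free_eqb (u v : word) : bool := `[< free_eq u v >].

Lemma free_eqb_refl : reflexive free_eqb.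
Proof. by move=> u; apply/asboolP; apply: free_eq_refl. Qed.

Lemma free_eqb_sym : symmetric free_eqb.
Proof. by move=> u v; apply/asboolP/asboolP; apply: free_eq_sym. Qed.

Lemma free_eqb_trans : transitive free_eqb.
Proof.
move=> v u w /asboolP uv /asboolP vw; apply/asboolP.
exact: free_eq_trans uv vw.
Qed.

Canonical free_eqb_equiv :=
  EquivRel free_eqb free_eqb_refl free_eqb_sym free_eqb_trans.

Definition free_group := {eq_quot free_eqb}.
HB.instance Definition _ := Choice.on free_group.
HB.instance Definition _ := EqQuotient.on free_group.

Lemma free_groupP (u v : word) :
  \pi_free_group u = \pi_free_group v <-> free_eq u v.
Proof.
split=> [/eqmodP/asboolP //|uv]; exact/eqmodP/asboolP.
Qed.

Lemma free_group_ind (P : free_group -> Prop) :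
  (forall u, P (\pi_free_group u)) -> forall a, P a.
Proof. by move=> h a; rewrite -[a]reprK. Qed.

Definition free_mul (a b : free_group) : free_group :=
  \pi_free_group (repr a ++ repr b).
Definition free_one : free_group := \pi_free_group [::].
Definition free_inv (a : free_group) : free_group :=
  \pi_free_group (word_inv (repr a)).

Lemma free_repr (u : word) : free_eq (repr (\pi_free_group u)) u.
Proof. by apply/free_groupP; rewrite reprK. Qed.

Lemma free_mulE (u v : word) :
  free_mul (\pi_free_group u) (\pi_free_group v) = \pi_free_group (u ++ v).
Proof.
apply/free_groupP/(@free_eq_trans _ (u ++ repr (\pi_free_group v))).
  exact/free_eq_catr/free_repr.
exact/free_eq_catl/free_repr.
Qed.

Lemma free_invE (u : word) :
  free_inv (\pi_free_group u) = \pi_free_group (word_inv u).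
Proof. exact/free_groupP/free_eq_inv/free_repr. Qed.

Lemma free_mulA : associative free_mul.
Proof.
move=> a b c; elim/free_group_ind: a => u.
elim/free_group_ind: b => v; elim/free_group_ind: c => w.
by rewrite !free_mulE catA.
Qed.

Lemma free_mul1 : left_id free_one free_mul.
Proof. by move=> a; elim/free_group_ind: a => u; rewrite free_mulE. Qed.

Lemma free_mulr1 : right_id free_one free_mul.
Proof. by move=> a; elim/free_group_ind: a => u; rewrite free_mulE cats0. Qed.

Lemma free_mulrV : right_inverse free_one free_inv free_mul.
Proof.
move=> a; elim/free_group_ind: a => u.
by rewrite free_invE free_mulE; apply/free_groupP/free_eq_mulV.
Qed.

Lemma free_mulV : left_inverse free_one free_inv free_mul.
Proof.
move=> a; elim/free_group_ind: a => u.
rewrite free_invE free_mulE -{2}[u]word_invK.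
exact/free_groupP/free_eq_mulV.
Qed.

HB.instance Definition _ := isGroup.Build free_group
  free_mulA free_mul1 free_mulr1 free_mulV free_mulrV.

End FreeGroup.

Section GroupNotions.
Variable G : groupType.

Definition subgroup (H : set G) : Prop := group_closed [in H].

Definition normal_subgroup (N : set G) : Prop :=
  subgroup N /\ forall x g, N x -> N (x ^ g).

Definition normal_closure (R : set G) : set G :=
  \bigcap_(N in [set N | normal_subgroup N /\ R `<=` N]) N.

Definition left_cosets (H : set G) : set (set G) :=
  [set [set x * h | h in H] | x in [set: G]].

Definition has_index (H : set G) (n : nat) : Prop := (left_cosets H #= `I_n)%card.

Definition subgroups_of_index (n : nat) : set (set G) :=
  [set H | subgroup H /\ has_index H n].

End GroupNotions.
Arguments subgroups_of_index G n : clear implicits.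

Definition ker (G H : groupType) (f : G -> H) : set G := [set g | f g = 1].

Definition finitely_presented (G : groupType) : Prop :=
  exists (m : nat) (R : set (free_group 'I_m))
         (f : {multiplicative free_group 'I_m -> G}),
    [/\ finite_set R, range f = [set: G] & ker f = normal_closure R].

(* [Algebra.to_multiplicative int] is the additive group of the integers, written
   multiplicatively. *)
Definition fp_Z_group (K : groupType) : Prop :=
  exists (G : groupType) (chi : {multiplicative G -> Algebra.to_multiplicative int})
         (iota : {multiplicative K -> G}),
    [/\ finitely_presented G, range chi = [set: Algebra.to_multiplicative int],
        injective iota & range iota = ker chi].

(* Main.v *)
Require Import Defs.
From mathcomp Require Import all_boot.
From mathcomp Require Import all_algebra all_fingroup.
From mathcomp Require Import boolp functions.
From mathcomp Require Import classical_sets cardinality.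
From mathcomp Require Import zify.

(* A homomorphism from K to a finite group S is a labelling by S of the edges of the graph
   with vertices h in Z and edges h -> h + chi(x_i), where the x_i generate G, such that
   the walks spelled by the relators, and by one fixed word of degree 1, evaluate to 1 from
   every vertex. These conditions are local and shift invariant, so labellings can be
   pasted where they agree on a long window.

   Suppose infinitely many labellings agree modulo an abelian normal subgroup. By the
   pigeonhole principle two of them agree around N and around -N but differ in between;
   their quotient is a cocycle of finite support, which twists any labelling l0 of the same
   class into one l1 that differs from l0 at finitely many heights only. When l0 is periodic,
   copies of l1 and of another such perturbation l2 can be placed at sparse heights in
   uncountably many ways.

   In degree at most 4, the retractions S_4 -> S_3 -> S_2 -> 1 have abelian kernels. At
   the first stage, starting from S_2, where there are infinitely many labellings, the
   labellings of the stage below are finite in number, hence periodic, so l0 and l1 exist.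
   Conjugates of l1 then serve to make the pasted labellings transitive. *)

Set Implicit Arguments.
Unset Strict Implicit.
Unset Printing Implicit Defensive.

Local Open Scope quotient_scope.
Local Open Scope classical_set_scope.
Local Open Scope group_scope.

(** * Labellings *)

Section Labelling.
Variables (m : nat) (c : 'I_m -> int).
Implicit Types (h : int) (w u v : word 'I_m).

Definition labelling (gT : finGroupType) := int -> {ffun 'I_m -> gT}.

Definition letter_height (p : 'I_m * bool) : int :=
  if p.2 then c p.1 else (- c p.1)%R.

Fixpoint height w : int :=
  if w is p :: w' then (letter_height p + height w')%R else 0%R.

(** An inverse letter walks backwards along the edge that ends at [h]; this edge starts at
    [h - c i]. *)
Definition letter_eval gT (l : labelling gT) h (p : 'I_m * bool) : gT :=
  if p.2 then l h p.1 else (l (h - c p.1)%R p.1)^-1.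

(* The product of the labels along the walk spelled by [w] from the vertex [h] of the
   graph with vertices [int] and edges [h --i--> h + c i]. *)
Fixpoint eval gT (l : labelling gT) h w : gT :=
  if w is p :: w' then letter_eval l h p * eval l (h + letter_height p)%R w'
  else 1.

Lemma height_cat u v : height (u ++ v) = (height u + height v)%R.
Proof. by elim: u => [|p u IHu] /=; rewrite ?add0r ?IHu; lia. Qed.

Lemma eval_cat gT (l : labelling gT) h u v :
  eval l h (u ++ v) = eval l h u * eval l (h + height u)%R v.
Proof.
elim: u h => [|p u IHu] h /=; first by rewrite mul1g GRing.addr0.
by rewrite IHu GRing.addrA mulgA.
Qed.

Lemma height_inv u : height (word_inv u) = (- height u)%R.
Proof.
elim: u => [|[i b] u IHu] //; rewrite word_inv_cons height_cat IHu /=.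
by rewrite /letter_height /=; case: b => /=; lia.
Qed.

Lemma eval_free_eq gT (l : labelling gT) h u v :
  free_eq u v -> eval l h u = eval l h v.
Proof.
move=> uv; elim: uv h => {u v} [u|u v _ IH|u v t _ IH1 _ IH2|u v i b] h //.
  by rewrite IH1.
rewrite !eval_cat; congr (_ * _); rewrite /= mulgA /letter_eval /letter_height.
by case: b => /=; rewrite ?GRing.addrK ?GRing.subrK ?mulgV ?mulVg mul1g.
Qed.

Lemma eval_inv gT (l : labelling gT) h u :
  eval l h (word_inv u) = (eval l (h - height u)%R u)^-1.
Proof.
apply: (mulIg (eval l (h - height u)%R u)); rewrite mulVg.
have := eval_free_eq l h (free_eq_mulV (word_inv u)).
by rewrite word_invK eval_cat height_inv.
Qed.

(** The morphism lives on a subgroup [D] because some maps used below are multiplicative only on a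
    subgroup of a product of groups. *)
Lemma eval_morph (aT rT : finGroupType) (D : {group aT}) (f : {morphism D >-> rT})
    (l : labelling aT) (k : labelling rT) h w :
    (forall h i, l h i \in D) -> (forall h i, k h i = f (l h i)) ->
  eval l h w \in D /\ eval k h w = f (eval l h w).
Proof.
move=> lD kE; elim: w h => [|[i b] w IHw] h /=; first by rewrite morph1.
have [wD ->] := IHw (h + letter_height (i, b))%R.
by rewrite /letter_eval; case: b wD => /= wD;
  rewrite kE morphM ?morphV ?groupM ?groupV ?lD.
Qed.

Definition speed := \max_i `|c i|%N.

Lemma eval_local gT (l k : labelling gT) h w :
    (forall h', (`|(h' - h)%R| <= size w * speed)%N -> l h' = k h') ->
  eval l h w = eval k h w.
Proof.
elim: w h => [|[i b] w IHw] h lk //=.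
have ci : (`|c i| <= speed)%N by rewrite /speed (leq_bigmax i).
rewrite /letter_eval (IHw (h + letter_height (i, b))%R).
  by case: b lk => /= lk; rewrite lk //=; lia.
by move=> h' hh'; apply: lk; move: hh'; rewrite /= /letter_height; case: (b) => /=; lia.
Qed.

Definition shift gT (d : int) (l : labelling gT) : labelling gT :=
  fun h => l (h + d)%R.

Lemma eval_shift gT d (l : labelling gT) h w :
  eval (shift d l) h w = eval l (h + d)%R w.
Proof.
elim: w h => [|[i b] w IHw] h //=; rewrite IHw /letter_eval /shift /= /letter_height.
by case: b => /=; rewrite !(GRing.addrAC _ d).
Qed.

Variable rel : seq (word 'I_m).

Definition flat gT : set (labelling gT) :=
  [set l | forall h r, r \in rel -> eval l h r = 1].

Definition radius := \max_(r <- rel) (size r * speed).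

(** A relator read from [h] sees only labels within [radius] of [h], so the witness [k] may vary
    with [h]. This is what makes pasting possible. *)
Lemma flat_local gT (l : labelling gT) :
    (forall h, exists2 k, flat k &
       forall h', (`|(h' - h)%R| <= radius)%N -> l h' = k h') ->
  flat l.
Proof.
move=> loc h r rR; have [k kF lk] := loc h.
rewrite (@eval_local _ l k) ?kF // => h' hh'; apply: lk; apply: leq_trans hh' _.
by rewrite /radius (big_rem r) //= leq_maxl.
Qed.

Lemma flat_shift gT d (l : labelling gT) : flat l -> flat (shift d l).
Proof. by move=> lF h r rR; rewrite eval_shift lF. Qed.

Lemma flat_morph (aT rT : finGroupType) (D : {group aT}) (f : {morphism D >-> rT})
    (l : labelling aT) (k : labelling rT) :
    (forall h i, l h i \in D) -> (forall h i, k h i = f (l h i)) ->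
  flat l -> flat k.
Proof.
by move=> lD kE lF h r rR; have [_ ->] := eval_morph h r lD kE; rewrite lF ?morph1.
Qed.

End Labelling.

(** * Labellings of finite support over a periodic one *)

Lemma infinite_seq T (S : set T) :
  infinite_set S -> exists2 e : nat -> T, (forall n, S (e n)) & injective e.
Proof.
elim/Ppointed: T => T in S *.
  by move=> S_inf; have [x] := infinite_setN0 S_inf; have := no x.
move=> /infiniteP/pcard_leP[e]; exists e => [n|p q epq]; first exact: funS.
by apply: (inj (f := e)); rewrite ?in_setT.
Qed.

(** Pigeonhole principle: otherwise [S] would be a finite union of finite fibers. *)
Lemma infinite_fiber T U (f : T -> U) (S : set T) :
  infinite_set S -> finite_set (f @` S) ->
  exists2 x, S x & infinite_set (S `&` [set y | f y = f x]).
Proof.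
move=> S_inf fS_fin; apply: contrapT => fib_fin; apply: S_inf.
apply: (@sub_finite_set _ _ (\bigcup_(u in f @` S) (S `&` [set y | f y = u]))).
  by move=> x Sx; exists (f x) => //; exists x.
apply: bigcup_finite => // _ [x Sx <-]; apply: contrapT => fib_inf.
by apply: fib_fin; exists x.
Qed.

Section Fork.
Variables (m : nat) (c : 'I_m -> int) (rel : seq (word 'I_m)).
Local Notation flat := (@flat m c rel _).
Local Notation radius := (radius c rel).

(* Among many distinct labellings two share the states on both windows around [N] and
   [-N]; the second one can then be spliced into the first one between [-N] and [N]. *)
Lemma flat_fork (gT : finGroupType) (S : set (labelling m gT)) :
    S `<=` flat -> infinite_set S ->
  exists l l' k : labelling m gT, exists N : nat,
    [/\ S l, S l', flat k & [/\ k <> l,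
        forall h, (N < `|h|)%N -> k h = l h &
        forall h, k h = l h \/ k h = l' h]].
Proof.
move=> S_flat /infinite_seq[e eS e_inj]; set W := radius.
pose state := {ffun 'I_(W.*2.+1) * bool -> {ffun 'I_m -> gT}}.
pose C := #|{: state}|.
have diff (p : 'I_C.+1 * 'I_C.+1) : {h : int | p.1 != p.2 -> e p.1 h <> e p.2 h}.
  apply: cid; have [_|p12] := eqVneq p.1 p.2; first by exists 0%R.
  have: e p.1 <> e p.2 by move/e_inj/val_inj/eqP; apply/negP.
  move=> eN; apply: contrapT => /forallNP same; apply/eN/funext => h.
  by apply: contrapT => ehN; apply: (same h).
(* Any two of the first [C.+1] labellings differ somewhere between [-N] and [N], whichever pair the
   pigeonhole principle picks afterwards. *)
pose N := \max_p `|sval (diff p)|%N.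
pose ends n : state := [ffun jb : 'I_(W.*2.+1) * bool =>
  let a := (N%:Z - W%:Z + (jb.1 : nat)%:Z)%R in e n (if jb.2 then a else (- a)%R)].
have /injectivePn[a [b ab eab]] : ~~ injectiveb (fun i : 'I_C.+1 => ends i).
  by apply/negP => /injectiveP /leq_card; rewrite card_ord /C ltnn.
have same h : (N <= `|h| + W)%N -> (`|h| <= N + W)%N -> e a h = e b h.
  move=> h1 h2; have j_lt : (`|h| + W - N < W.*2.+1)%N by lia.
  have /ffunP/(_ (Ordinal j_lt, (0 <= h)%R)) := eab; rewrite !ffunE /=.
  by case: ifP => h0; [have -> : (N%:Z - W%:Z + (`|h| + W - N)%N%:Z)%R = h by lia
    | have -> : (- (N%:Z - W%:Z + (`|h| + W - N)%N%:Z))%R = h by lia].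
pose k h := if (`|h| <= N)%N then e b h else e a h.
exists (e a), (e b), k, N; split=> //; last split.
(* Within distance [W] of [h], [k] agrees with [e b] or with [e a] throughout, because it switches
   inside windows where these two coincide. *)
- apply: flat_local => h.
  have [hN|hN] := leqP `|h| N; [exists (e b)|exists (e a)]; try exact/S_flat/eS.
    move=> h' hh'; rewrite /k; case: ifP => // /negP h'N.
    by apply: same; rewrite -/W in hh' *; lia.
  move=> h' hh'; rewrite /k; case: ifP => // h'N.
  by apply/esym/same; rewrite -/W in hh' *; lia.
- have hN : (`|sval (diff (a, b))| <= N)%N.
    exact: (leq_bigmax (F := fun p => `|sval (diff p)|%N) (a, b)).
  move=> /(congr1 (fun f => f (sval (diff (a, b))))); rewrite /k hN => /esym.
  exact: (svalP (diff (a, b))).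
- by move=> h hN; rewrite /k leqNgt hN.
- by move=> h; rewrite /k; case: ifP; [right|left].
Qed.

End Fork.

Section Homoclinic.
Variables (m : nat) (c : 'I_m -> int) (rel : seq (word 'I_m)).
Local Notation flat := (@flat m c rel _).

Definition pair_labelling (aT bT : finGroupType) (l : labelling m aT)
    (k : labelling m bT) : labelling m (aT * bT)%type :=
  fun h => [ffun i => (l h i, k h i)].

Lemma flat_pair (aT bT : finGroupType) (l : labelling m aT) (k : labelling m bT) :
  flat l -> flat k -> flat (pair_labelling l k).
Proof.
move=> lF kF h r rR; suff -> : eval c (pair_labelling l k) h r =
  (eval c l h r, eval c k h r) by rewrite lF ?kF.
elim: r h {rR} => [|[i b] w IHw] h //=; rewrite IHw /letter_eval /=.
by case: b; rewrite ffunE.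
Qed.

(** By finiteness two shifts by natural numbers coincide, and their difference is a period. *)
Lemma flat_periodic (gT : finGroupType) (Y : set (labelling m gT)) l :
    finite_set Y -> (forall d k, Y k -> Y (shift d k)) -> Y l ->
  exists2 P, (0 < P)%N & shift P%:Z l = l.
Proof.
move=> Y_fin Y_shift Yl; apply: contrapT => noP.
pose e (n : nat) : labelling m gT := shift n%:Z l.
suff e_inj : injective e.
  apply: infinite_nat; have eT : finite_set (e @` [set: nat]).
    by apply: (@sub_finite_set _ _ Y) => // _ [n _ <-]; apply: Y_shift.
  by rewrite -(eq_finite_set (inj_card_eq (in2W e_inj))).
move=> a b; wlog ab : a b / (a < b)%N => [th|].
  by case: (ltngtP a b) => [ab|ba|//] eab; [apply: th | apply/esym/th].
move=> eab; case: noP; exists (b - a)%N; first lia.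
apply/funext => h; have := congr1 (fun f => f (h - a%:Z)%R) eab.
by rewrite /e /shift GRing.subrK => ->; congr l; lia.
Qed.

Variables (gT : finGroupType) (H : {group gT}) (p : gT -> gT).
Hypotheses (pM : {in H &, {morph p : x y / x * y}}) (pH : {in H, forall x, p x \in H})
  (pp : {in H, forall x, p (p x) = p x})
  (pC : {in H &, forall x y, p x = 1 -> p y = 1 -> commute x y}).

Definition valued (A : {set gT}) : set (labelling m gT) :=
  [set l | forall h i, l h i \in A].

Let p1 : p 1 = 1.
Proof. by apply: (mulgI (p 1)); rewrite -pM ?mulg1. Qed.

Let pV : {in H, {morph p : x / x^-1}}.
Proof.
by move=> x xH; apply: (mulgI (p x)); rewrite -pM ?groupV // !mulgV p1.
Qed.

(** The ternary operation of a heap: [z] twisted by the quotient of [x] by [y]. *)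
Definition heap (x y z : labelling m gT) : labelling m gT :=
  fun h => [ffun i => x h i * (y h i)^-1 * z h i].

(** On triples with equal images under [p], sending [(x, y, z)] to [x * y^-1 * z] is a homomorphism
    because the kernel of [p] is abelian. *)
Lemma flat_heap (x y z : labelling m gT) :
    valued H x -> valued H y -> valued H z ->
    (forall h i, p (x h i) = p (z h i)) -> (forall h i, p (y h i) = p (z h i)) ->
  flat x -> flat y -> flat z -> flat (heap x y z).
Proof.
move=> xH yH zH xz yz xF yF zF.
pose D := [set t : gT * gT * gT | [&& t.1.1 \in H, t.1.2 \in H, t.2 \in H,
  p t.1.1 == p t.2 & p t.1.2 == p t.2]]%SET.
have D_group : group_set D.
  apply/group_setP; split; first by rewrite inE /= !group1 !eqxx.
  move=> t u; rewrite !inE /= => /and5P[t1 t2 t3 /eqP t4 /eqP t5].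
  case/and5P=> [u1 u2 u3 /eqP u4 /eqP u5]; rewrite !groupM //=.
  by rewrite !pM // t4 t5 u4 u5 !eqxx.
pose f (t : gT * gT * gT) := t.1.1 * t.1.2^-1 * t.2.
have fM : {in D &, {morph f : t u / t * u}}.
  move=> [[t1 t2] t3] [[u1 u2] u3]; rewrite !inE /=.
  move=> /and5P[t1H t2H t3H /eqP t13 /eqP t23].
  move=> /and5P[u1H u2H u3H /eqP u13 /eqP u23].
  rewrite /f /=.
  (* The two sides are [a * b * d * t2 * u3] and [a * d * b * t2 * u3], with [b] and [d] in the
     kernel. *)
  pose a := t1 * t2^-1; pose b := t2 * (u1 * u2^-1) * t2^-1; pose d := t3 * t2^-1.
  have [aH bH dH] : [/\ a \in H, b \in H & d \in H] by rewrite !(groupM, groupV).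
  have ker_a : p a = 1 by rewrite pM ?groupV // pV // t13 t23 mulgV.
  have ker_d : p d = 1 by rewrite pM ?groupV // pV // t23 mulgV.
  have ker_b : p b = 1.
    by rewrite !pM ?groupM ?groupV // !pV // u13 u23 mulgV mulg1 mulgV.
  have -> : t1 * u1 * (t2 * u2)^-1 * (t3 * u3) = a * (b * d) * t2 * u3.
    by rewrite /a /b /d invMg !mulgA !mulgKV.
  have -> : t1 * t2^-1 * t3 * (u1 * u2^-1 * u3) = a * (d * b) * t2 * u3.
    by rewrite /a /b /d !mulgA !mulgKV.
  by rewrite (pC bH dH ker_b ker_d).
apply: (flat_morph (D := Group D_group) (f := Morphism fM)
  (l := pair_labelling (pair_labelling x y) z)).
- by move=> h i; rewrite !ffunE inE /= xH yH zH xz yz !eqxx.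
- by move=> h i; rewrite !ffunE.
- by do 2?apply: flat_pair.
Qed.

(* Two labellings in one fiber of [p] that agree far away differ by a cocycle of finite
   support with values in the abelian kernel of [p]; it twists [p \o l] into [l1]. *)
Lemma flat_homoclinic (S : set (labelling m gT)) :
    S `<=` flat -> S `<=` valued H -> infinite_set S ->
    finite_set [set l | flat l /\ forall h i, l h i \in H /\ p (l h i) = l h i] ->
  exists l0 l1 : labelling m gT, exists N P : nat,
    [/\ flat l0, flat l1,
      forall h i, [/\ l0 h i \in H, l1 h i \in H & p (l1 h i) = l0 h i],
      l1 <> l0 & [/\ forall h, (N < `|h|)%N -> l1 h = l0 h,
        (0 < P)%N & shift P%:Z l0 = l0]].
Proof.
move=> S_flat S_H S_inf fix_fin; pose q (l : labelling m gT) : labelling m gT :=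
  fun h => [ffun i => p (l h i)].
pose fixp := [set l : labelling m gT |
  flat l /\ forall h i, l h i \in H /\ p (l h i) = l h i].
have q_flat l : valued H l -> flat l -> fixp (q l).
  move=> lH lF; split; last by move=> h i; rewrite ffunE pp // pH.
  apply: (flat_morph (D := H) (f := Morphism pM) lH _ lF) => h i.
  by rewrite ffunE.
have [l Sl lS_inf] : exists2 l, S l & infinite_set (S `&` [set k | q k = q l]).
  apply: infinite_fiber => //; apply: (sub_finite_set _ fix_fin).
  by move=> _ [l Sl <-]; apply: q_flat; [apply: S_H | apply: S_flat].
have lS_flat : S `&` [set k | q k = q l] `<=` flat by move=> k [/S_flat].
have [x [y [k [N [[Sx qx] [Sy qy] kF [kx kN kxy]]]]]] := flat_fork lS_flat lS_inf.
have qE z : q z = q l -> forall h i, p (z h i) = q l h i.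
  by move=> <- h i; rewrite ffunE.
have xH := S_H _ Sx; have lH := S_H _ Sl.
have kH : valued H k by move=> h i; case: (kxy h) => ->; [apply: xH | apply: S_H].
have pk h i : p (k h i) = q l h i by case: (kxy h) => ->; apply: qE.
have [qF q_fix] := q_flat l lH (S_flat _ Sl).
have qH : valued H (q l) by move=> h i; have [] := q_fix h i.
have pq h i : p (q l h i) = q l h i by have [] := q_fix h i.
(* The quotient of [k] by [x] is trivial beyond [N], so twisting by it changes [q l] at finitely
   many heights only. *)
exists (q l), (heap k x (q l)).
have [P P0 lP] : exists2 P, (0 < P)%N & shift P%:Z (q l) = q l.
  apply: flat_periodic fix_fin _ (conj qF q_fix) => d z [zF zfix].
  by split=> [|h i]; [apply: flat_shift | apply: zfix].
exists N, P; split=> //.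
- by apply: flat_heap => //; try exact: S_flat; move=> h i; rewrite pq ?pk ?qE.
- move=> h i; split; rewrite ?qH //; rewrite ffunE.
    by rewrite !groupM ?groupV ?kH ?xH ?qH.
  by rewrite !pM ?groupM ?groupV ?kH ?xH ?qH // pV // ?xH // pk (qE x) // pq mulgV mul1g.
- move=> E; apply: kx; apply/funext => h; apply/ffunP => i.
  have := congr1 (fun f : labelling m gT => f h i) E; rewrite ffunE.
  by move/(canRL (mulgK _)); rewrite mulgV => /eqP; rewrite -eq_mulgV1 => /eqP.
- split=> // h hN; apply/ffunP => i.
  by rewrite ffunE kN // mulgV mul1g.
Qed.

End Homoclinic.

(** * Pasting *)

Lemma uncountable_cantor_space T (A : set T) (e : (nat -> bool) -> T) :
  (forall s, A (e s)) -> injective e -> ~ countable A.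
Proof.
move=> eA e_inj /countable_injP[f f_inj].
(* Diagonal sequence: its value at [f (e s)] would have to be its own negation. *)
pose s n := `[< forall t, f (e t) = n -> ~~ t n >].
have [sn|/asboolPn sn] := boolP (s (f (e s))); last first.
  apply: (sn) => t /f_inj; rewrite !inE => /(_ (eA t) (eA s)) /e_inj ->.
  exact/asboolPn.
by move/asboolP: (sn) => /(_ s erefl); rewrite sn.
Qed.

Section Splice.
Variables (m : nat) (c : 'I_m -> int) (rel : seq (word 'I_m)) (gT : finGroupType).
Local Notation flat := (@flat m c rel gT).
Variables (l0 : labelling m gT) (N P : nat).
Hypotheses (P_gt0 : (0 < P)%N) (l0P : shift P%:Z l0 = l0).

(** Copy [k] is centred at [k * Q] and governs the [Q] heights from [k * Q - M] on. As [Q] exceeds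
    [2 * M], perturbations in distinct blocks are more than [radius] apart; as [P] divides [Q], all
    copies share one background. *)
Let M := (N + radius c rel)%N.
Let Q : int := (P * (M.*2.+1))%N%:Z.
Let block (h : int) : int := ((h + M%:Z) %/ Q)%Z.

Let Q_gt : (M.*2%:Z < Q)%R.
Proof. by rewrite /Q; nia. Qed.

Let block_bound h : (- M%:Z <= h - block h * Q)%R /\ (h - block h * Q < Q - M%:Z)%R.
Proof.
have Q0 : (0 < Q)%R by lia.
have QN0 : Q != 0%R by lia.
have := divz_eq (h + M%:Z) Q; rewrite -/(block h).
have := ltz_pmod (h + M%:Z) Q0; have := modz_ge0 (h + M%:Z) QN0.
lia.
Qed.

Let block_eq h k : (- M%:Z <= h - k * Q)%R -> (h - k * Q < Q - M%:Z)%R -> block h = k.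
Proof. by move=> h1 h2; have := block_bound h; nia. Qed.

Let l0_periodic h k : l0 (h + k * Q)%R = l0 h.
Proof.
have nat_mul n h' : l0 (h' + (n * P)%N%:Z)%R = l0 h'.
  elim: n => [|n IHn]; first by rewrite mul0n GRing.addr0.
  have := congr1 (fun f : labelling m gT => f (h' + (n * P)%N%:Z)%R) l0P.
  by rewrite IHn => <-; rewrite /shift; congr l0; lia.
case: k => n.
  by rewrite -[RHS](nat_mul (n * M.*2.+1)%N); congr l0; rewrite /Q; lia.
rewrite -[LHS](nat_mul (n.+1 * M.*2.+1)%N); congr l0; rewrite NegzE /Q; lia.
Qed.

Definition splice (g : int -> labelling m gT) : labelling m gT :=
  fun h => g (block h) (h - block h * Q)%R.

Variable g : int -> labelling m gT.
Hypotheses (gF : forall k, flat (g k))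
  (gN : forall k h, (N < `|h|)%N -> g k h = l0 h).

(** A height within [radius] of [h] but in another block is more than [N] away from both centres.
    Both copies show [l0] there, and [Q] is a period of [l0]. *)
Lemma flat_splice : flat (splice g).
Proof.
apply: flat_local => h; set k := block h.
exists (shift (- (k * Q))%R (g k)); first exact: flat_shift.
move=> h' hh'; rewrite /shift /splice; have [->//|k'k] := eqVneq (block h') k.
have := block_bound h; have := block_bound h'; rewrite -/k.
move: (block h') k'k => k' k'k [h'1 h'2] [h1 h2].
have {}k'k : (k' * Q + Q <= k * Q)%R \/ (k * Q + Q <= k' * Q)%R.
  have [k'lt|k'gt] : (k' + 1 <= k)%R \/ (k + 1 <= k')%R by lia.
    by left; move: Q_gt; nia.
  by right; move: Q_gt; nia.
have kQ := l0_periodic (h' - k' * Q)%R k'; have k'Q := l0_periodic (h' - k * Q)%R k.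
rewrite !gN; first by rewrite -kQ -k'Q !GRing.subrK.
- by move: (k * Q)%R (k' * Q)%R {kQ k'Q} k'k h'1 h'2 h1 h2 hh' Q_gt => ? ?;
    rewrite /M; lia.
- by move: (k * Q)%R (k' * Q)%R {kQ k'Q} k'k h'1 h'2 h1 h2 hh' Q_gt => ? ?;
    rewrite /M; lia.
Qed.

Lemma spliceE k h : (`|h| <= N)%N -> splice g (h + k * Q)%R = g k h.
Proof.
move=> hN; rewrite /splice; suff -> : block (h + k * Q)%R = k by rewrite GRing.addrK.
by apply: block_eq; rewrite GRing.addrK; have := Q_gt; rewrite /M; lia.
Qed.

(** A multiple of [Q] moves [h] into block [k], so one unperturbed copy exhibits every label of
    [l0]. *)
Lemma splice_background k h : g k = l0 -> exists h', splice g h' = l0 h.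
Proof.
move=> gk; exists (h - block h * Q + k * Q)%R; rewrite /splice.
have [h1 h2] := block_bound h.
have -> : block (h - block h * Q + k * Q)%R = k by apply: block_eq; rewrite GRing.addrK.
by rewrite GRing.addrK gk -(l0_periodic _ (block h)) GRing.subrK.
Qed.

End Splice.

(** * Small permutation groups *)

Section Transitive.
Variables (m : nat) (c : 'I_m -> int) (rel : seq (word 'I_m)) (X : finType).
Local Notation flat := (@flat m c rel _).

Definition stable (l : labelling m {perm X}) (B : {set X}) :=
  forall h i x, x \in B -> l h i x \in B.

Definition transitive_labelling (l : labelling m {perm X}) :=
  forall B : {set X}, B != finset.set0 -> stable l B -> B = [set: X]%SET.

Definition transitive_flat : set (labelling m {perm X}) :=
  [set l | flat l /\ transitive_labelling l].

Lemma uncountable_transitive (l0 l1 l2 : labelling m {perm X}) (N P : nat) :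
    flat l0 -> flat l1 -> flat l2 -> (0 < P)%N -> shift P%:Z l0 = l0 ->
    (forall h, (N < `|h|)%N -> l1 h = l0 h) ->
    (forall h, (N < `|h|)%N -> l2 h = l0 h) -> l1 <> l2 ->
    (forall B : {set X}, B != finset.set0 -> stable l0 B -> stable l1 B -> stable l2 B ->
      B = [set: X]%SET) ->
  ~ countable transitive_flat.
Proof.
move=> l0F l1F l2F P0 l0P l1N l2N l12 tr.
(* The sequence [s] chooses between [l1] and [l2] in the blocks from 0 on. The negative blocks do
   not depend on [s] and exhibit [l0], [l1] and [l2], which ensures transitivity for every [s]. *)
pose g (s : nat -> bool) (k : int) := match k with
  | Posz n => if s n then l1 else l2
  | Negz 0 => l0 | Negz 1 => l1 | Negz _ => l2 end.
have gF s k : flat (g s k) by case: k => [n|[|[|n]]] //=; case: ifP.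
have gN s k h : (N < `|h|)%N -> g s k h = l0 h.
  by move=> hN; case: k => [n|[|[|n]]] //=; rewrite ?l1N ?l2N //; case: ifP => _; auto.
refine (@uncountable_cantor_space _ _ (fun s => splice c rel N P (g s)) _ _).
  move=> s; split; first exact: (flat_splice P0 l0P (gF s) (gN s)).
  move=> B B0 sB.
  have s0 : stable l0 B.
    move=> h i x xB.
    have [h' <-] := splice_background c rel N P0 l0P h
      (erefl : g s (Negz 0) = l0).
    exact: sB.
  have sk k : stable (g s k) B.
    move=> h i x xB; have [hN|hN] := leqP `|h| N; last by rewrite gN ?s0.
    by rewrite -(spliceE c rel P0 (g s) k hN) sB.
  exact: tr B0 s0 (sk (Negz 1)) (sk (Negz 2)).
(* At [h0] the two perturbations differ, so the label at [h0 + n * Q] reveals [s n]. *)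
have [h0 h0P] : exists h, l1 h <> l2 h.
  by apply: contrapT => /forallNP same; apply/l12/funext => h; apply: contrapT; apply: same.
have h0N : (`|h0| <= N)%N.
  by rewrite leqNgt; apply/negP => h0N; apply: h0P; rewrite l1N ?l2N.
move=> s s' E; apply/funext => n.
have := spliceE c rel P0 (g s) (Posz n) h0N.
rewrite E (spliceE c rel P0 (g s') (Posz n) h0N) /=.
by case: (s n) (s' n) => [] [] // /esym // /esym.
Qed.

End Transitive.
Arguments transitive_flat {m} c rel X.

(** By finiteness an injective map of [B] into itself is onto. *)
Lemma perm_closedV (X : finType) (z : {perm X}) (B : {set X}) :
  {in B, forall x, z x \in B} -> {in B, forall x, z^-1 x \in B}.
Proof.
move=> zB x xB; have lB : z @: B = B.
  apply/eqP; rewrite eqEcard card_imset ?leqnn ?andbT; last exact: perm_inj.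
  by apply/fintype.subsetP => _ /imsetP[y yB ->]; apply: zB.
by move: xB; rewrite -{1}lB => /imsetP[y yB ->]; rewrite permK.
Qed.

(** * Even permutations of three points *)

Section Perm3.
Variables (X : finType) (a b d : X).
Hypotheses (ab : a != b) (ad : a != d) (bd : b != d).

Lemma perm_on2 (x : {perm X}) :
  (forall y, y != b -> y != d -> x y = y) -> x = 1 \/ x = tperm b d.
Proof.
move=> xfix.
have xb : x b = b \/ x b = d.
  have [|xbb] := eqVneq (x b) b; first by left.
  have [|xbd] := eqVneq (x b) d; first by right.
  by case/eqP: (xbb); apply: (@perm_inj _ x); rewrite (xfix _ xbb xbd).
have xd : x d = b \/ x d = d.
  have [|xdb] := eqVneq (x d) b; first by left.
  have [|xdd] := eqVneq (x d) d; first by right.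
  by case/eqP: (xdd); apply: (@perm_inj _ x); rewrite (xfix _ xdb xdd).
have xbd : x b != x d by rewrite (inj_eq perm_inj).
case: xb xd xbd => xb [] xd; rewrite xb xd ?eqxx // => _; [left|right];
  apply/permP => y; rewrite ?perm1; have [->|yb] := eqVneq y b; rewrite ?tpermL //;
  by have [->|yd] := eqVneq y d; rewrite ?tpermR // xfix // tpermD // eq_sym.
Qed.

Definition cycle3 := tperm b d * tperm a b.

Lemma cycle3E : [/\ cycle3 a = b, cycle3 b = d & cycle3 d = a].
Proof.
rewrite /cycle3 !permM; split.
- by rewrite (tpermD (x := b)) ?tpermL // eq_sym.
- by rewrite tpermL tpermD // eq_sym.
- by rewrite !tpermR.
Qed.

(** Following [x] by the transposition of [a] and [x a] leaves a permutation of [b] and [d], and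
    parity decides which one. *)
Lemma even_perm3 (x : {perm X}) :
    (forall y, y != a -> y != b -> y != d -> x y = y) -> ~~ odd_perm x ->
  [\/ x = 1, x = cycle3 | x = cycle3^-1].
Proof.
move=> xfix x_even; pose y := x * tperm a (x a).
have xE : x = y * tperm a (x a) by rewrite /y -mulgA tperm2 mulg1.
have ya : y a = a by rewrite permM tpermR.
have xa : [\/ x a = a, x a = b | x a = d].
  have [|xaa] := eqVneq (x a) a; first by constructor.
  have [|xab] := eqVneq (x a) b; first by constructor.
  have [|xad] := eqVneq (x a) d; first by constructor.
  by case/eqP: (xaa); apply: (@perm_inj _ x); rewrite (xfix _ xaa xab xad).
have y_bd : y = 1 \/ y = tperm b d.
  apply: perm_on2 => w wb wd; have [->//|wa] := eqVneq w a.
  rewrite /y permM (xfix w) // tpermD //; first by rewrite eq_sym.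
  by case: xa => ->; rewrite eq_sym.
have y_odd : odd_perm y = (x a != a).
  by rewrite odd_permM (negbTE x_even) odd_tperm eq_sym.
case: y_bd y_odd => yE; rewrite yE ?odd_perm1 ?odd_tperm ?bd => xaa.
  by rewrite xE yE (eqP (negbFE (esym xaa))) tperm1 mulg1; constructor.
case: xa => xaE; rewrite xaE ?eqxx // in xaa *; rewrite xE yE xaE; first by constructor 2.
constructor 3; apply: (mulIg cycle3); rewrite mulVg /cycle3.
have -> : tperm b d * tperm a d * (tperm b d * tperm a b) =
    tperm a d ^ tperm b d * tperm a b by rewrite conjgE tpermV !mulgA.
by rewrite tpermJ tpermR tpermD ?tperm2 // eq_sym.
Qed.

Lemma even_perm3C (x y : {perm X}) :
    (forall w, w != a -> w != b -> w != d -> x w = w) ->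
    (forall w, w != a -> w != b -> w != d -> y w = w) ->
  ~~ odd_perm x -> ~~ odd_perm y -> commute x y.
Proof.
move=> xfix yfix /(even_perm3 xfix) x3 /(even_perm3 yfix) y3.
have cyc z : [\/ z = 1, z = cycle3 | z = cycle3^-1] -> z \in <[cycle3]>.
  by case=> ->; rewrite ?groupV ?group1 ?cycle_id.
exact: (centsP (cycle_abelian cycle3)) _ (cyc _ x3) _ (cyc _ y3).
Qed.

Lemma even_perm3_closed (x : {perm X}) (B : {set X}) :
    (forall y, y != a -> y != b -> y != d -> x y = y) -> ~~ odd_perm x -> x != 1 ->
    {in B, forall y, x y \in B} ->
  [/\ a \in B -> b \in B, b \in B -> d \in B & d \in B -> a \in B].
Proof.
move=> xfix x_even x1 xB; have [ca cb cd] := cycle3E.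
suff cB : {in B, forall y, cycle3 y \in B} by split=> /cB; rewrite ?ca ?cb ?cd.
case: (even_perm3 xfix x_even) => xE; first by rewrite xE eqxx in x1.
  by rewrite -xE.
by rewrite -[cycle3]invgK -xE; apply: perm_closedV.
Qed.

End Perm3.

(** * Sign labellings and degree two *)

Section SmallDegree.
Variables (m : nat) (c : 'I_m -> int) (rel : seq (word 'I_m)).
Local Notation flat := (@flat m c rel _).
Local Notation transitive_flat := (transitive_flat c rel).

Definition trivial_labelling (gT : finGroupType) : labelling m gT :=
  fun=> [ffun=> 1].
Local Notation triv := (@trivial_labelling _).

Lemma flat_trivial (gT : finGroupType) : flat (trivial_labelling gT).
Proof.
move=> h r _; elim: r h => [|[i []] r IHr] h //=;
  by rewrite IHr /letter_eval /= ffunE ?invg1 mulg1.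
Qed.

Lemma labelling_neq (gT : finGroupType) (l k : labelling m gT) :
  l <> k -> exists h i, l h i != k h i.
Proof.
move=> lk; apply: contrapT => same; apply/lk/funext => h; apply/ffunP => i.
by apply/eqP; apply: contrapT => /negP lkhi; apply: same; exists h, i.
Qed.

(** For [X = Y] and an odd involution [v], this is the retraction of the symmetric group onto the
    group generated by [v]; its kernel is the alternating group. *)
Definition sign_power (X Y : finType) (v : {perm Y}) (x : {perm X}) : {perm Y} :=
  if odd_perm x then v else 1.

Lemma sign_powerM (X Y : finType) (v : {perm Y}) :
  v * v = 1 -> {morph @sign_power X Y v : x y / x * y}.
Proof.
move=> vv x y; rewrite /sign_power odd_permM.
by case: (odd_perm x) (odd_perm y) => [] []; rewrite ?mulg1 ?mul1g.
Qed.

Lemma flat_sign_power (X Y : finType) (v : {perm Y}) (l : labelling m {perm X})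
    (k : labelling m {perm Y}) :
    v * v = 1 -> (forall h i, k h i = sign_power v (l h i)) ->
  flat l -> flat k.
Proof.
move=> vv kE; apply: (flat_morph (D := [set: {perm X}]%G)
  (f := Morphism (in2W (sign_powerM vv)))) => // h i; exact: finset.in_setT.
Qed.

Lemma perm_bool (x : {perm bool}) : x = 1 \/ x = tperm false true.
Proof. by apply: perm_on2 => // -[]. Qed.

Definition flat_sign : set (labelling m {perm bool}) := [set l | flat l].

(** The retraction used here sends everything to 1, so the background is trivial. *)
Lemma flat_sign_homoclinic : infinite_set flat_sign ->
  exists l : labelling m {perm bool}, exists N, [/\ flat l,
    forall h, (N < `|h|)%N -> l h = triv h & exists h i, l h i = tperm false true].
Proof.
move=> inf; have [] := @flat_homoclinic m c rel {perm bool} [set: {perm bool}]%G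
  (fun=> 1) _ _ _ _ flat_sign _ _ inf.
- by move=> x y _ _; rewrite mulg1.
- by [].
- by [].
- move=> x y _ _ _ _; case: (perm_bool x) (perm_bool y) => -> [] ->;
    by [apply: commute1|apply/commute_sym/commute1|].
- by [].
- by move=> l _ h i; rewrite finset.in_setT.
- apply: (sub_finite_set _ (finite_set1 triv)) => l [_ lE].
  by apply/funext => h; apply/ffunP => i; rewrite ffunE; have [_ <-] := lE h i.
move=> l0 [l1 [N [P [l0F l1F l01 l10 [lN _ _]]]]].
have l0E : l0 = triv.
  by apply/funext => h; apply/ffunP => i; rewrite ffunE; have [_ _ <-] := l01 h i.
exists l1, N; split=> //; first by rewrite -l0E.
have [h [i hi]] := labelling_neq l10; exists h, i.
by case: (perm_bool (l1 h i)) => // E; move: hi; rewrite E l0E ffunE eqxx.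
Qed.

Lemma transitive_flat2 :
  finite_set (transitive_flat bool) \/ ~ countable (transitive_flat bool).
Proof.
apply: contrapT => /not_orP[T_inf]; apply.
have /flat_sign_homoclinic[l [N [lF lN [h [i hi]]]]] : infinite_set flat_sign.
  by apply: sub_infinite_set T_inf => l [].
apply: (uncountable_transitive (P := 1) (flat_trivial _) lF (flat_trivial _) _ _ lN) => //.
  move/(congr1 (fun k : labelling m {perm bool} => k h i false)).
  by rewrite hi ffunE tpermL perm1.
move=> B /set0Pn[x xB] _ lB _; apply/setP => y; rewrite finset.in_setT.
have := lB h i x xB; rewrite hi; case: x y xB => [] [] //; by rewrite ?tpermL ?tpermR.
Qed.

(** A sign labelling of finite support is copied into the groups generated by [v] and by [v']; both
    copies perturb the trivial labelling and can be pasted. *)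
Lemma flat_sign_uncountable (X : finType) (v v' : {perm X}) :
    v * v = 1 -> v' * v' = 1 -> v != v' ->
    (forall B : {set X}, B != finset.set0 -> {in B, forall x, v x \in B} ->
      {in B, forall x, v' x \in B} -> B = [set: X]%SET) ->
  infinite_set flat_sign -> ~ countable (transitive_flat X).
Proof.
move=> vv vv' vNv' tr /flat_sign_homoclinic[l [N [lF lN [h [i hi]]]]].
pose k (u : {perm X}) : labelling m {perm X} := fun h => [ffun i => sign_power u (l h i)].
have kF u : u * u = 1 -> flat (k u).
  by move=> uu; apply: flat_sign_power uu _ lF => g j; rewrite ffunE.
have kN u g : (N < `|g|)%N -> k u g = triv g.
  by move=> /lN lg; apply/ffunP => j; rewrite !ffunE lg ffunE /sign_power odd_perm1.
have khi u : k u h i = u by rewrite ffunE hi /sign_power odd_tperm.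
apply: (uncountable_transitive (P := 1) (flat_trivial _) (kF v vv) (kF v' vv')
  _ _ (kN v) (kN v')) => //.
  by move/(congr1 (fun f : labelling m {perm X} => f h i)); rewrite !khi; apply/eqP.
move=> B B0 _ vB v'B; apply: tr => // x xB; first by rewrite -(khi v) vB.
by rewrite -(khi v') v'B.
Qed.

(** A labelling fixed by the retraction is recovered from its signs. *)
Lemma finite_involution_labellings (X : finType) (t : {perm X}) :
    t * t = 1 -> odd_perm t -> finite_set flat_sign ->
  finite_set [set l | flat l /\ forall h i, sign_power t (l h i) = l h i].
Proof.
move=> tt t_odd fin.
pose k (l : labelling m {perm bool}) : labelling m {perm X} :=
  fun h => [ffun i => sign_power t (l h i)].
apply: (sub_finite_set _ (finite_image k fin)) => l [lF lE].
exists (fun h => [ffun i => sign_power (tperm false true) (l h i)]).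
  apply: (flat_sign_power (v := tperm false true) _ _ lF) => [|h i]; rewrite ?ffunE //.
  exact: tperm2.
apply/funext => h; apply/ffunP => i; rewrite !ffunE -[RHS]lE /sign_power.
by case: (odd_perm (l h i)); rewrite ?odd_tperm ?odd_perm1.
Qed.

End SmallDegree.

(** * Degree three *)

Section Degree34.
Variables (m : nat) (c : 'I_m -> int) (rel : seq (word 'I_m)).
Local Notation flat := (@flat m c rel _).
Local Notation transitive_flat := (transitive_flat c rel).
Local Notation flat_sign := (flat_sign c rel).

Lemma odd_sign_power (X Y : finType) (t : {perm Y}) (x : {perm X}) :
  odd_perm t -> odd_perm (sign_power t x) = odd_perm x.
Proof. by rewrite /sign_power; case: (odd_perm x) => //; rewrite odd_perm1. Qed.

Lemma sign_power_eq1 (X Y : finType) (t : {perm Y}) (x : {perm X}) :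
  odd_perm t -> sign_power t x = 1 -> ~~ odd_perm x.
Proof. by move=> t_odd x1; rewrite -(odd_sign_power x t_odd) x1 odd_perm1. Qed.

Lemma cycle_option_bool (B : {set option bool}) :
    B != finset.set0 -> (None \in B -> Some false \in B) ->
    (Some false \in B -> Some true \in B) -> (Some true \in B -> None \in B) ->
  B = [set: option bool]%SET.
Proof.
move=> /set0Pn[x xB] ab bd da; apply/setP => y; rewrite finset.in_setT.
have aB : None \in B by case: x xB => [[]|] xB; [apply: da | apply/da/bd | ].
by case: y => [[]|]; [apply/bd/ab | apply: ab | ].
Qed.

(** With infinitely many sign labellings, two transpositions that generate [S_3] suffice. Otherwise
    [l1] differs from [l0] by a 3-cycle on some edge; this forces transitivity, so [l0] itself can
    be the second perturbation. *)
Lemma transitive_flat3 :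
  finite_set (transitive_flat (option bool)) \/ ~ countable (transitive_flat (option bool)).
Proof.
apply: contrapT => /not_orP[T_inf]; apply.
pose a : option bool := None; pose b := Some false; pose d := Some true.
have [sign_fin|sign_inf] := pselect (finite_set flat_sign); last first.
  apply: (flat_sign_uncountable (v := tperm a b) (v' := tperm b d)) sign_inf.
  - exact: tperm2.
  - exact: tperm2.
  - by apply/eqP => /permP/(_ a); rewrite !permE.
  - move=> B B0 vB v'B; apply: (cycle_option_bool B0).
    + by move/vB; rewrite tpermL.
    + by move/v'B; rewrite tpermL.
    + by move/v'B; rewrite tpermR => /vB; rewrite tpermR.
have t_odd : odd_perm (tperm a b) by rewrite odd_tperm.
have tt : tperm a b * tperm a b = 1 := tperm2 a b.
have [] := @flat_homoclinic m c rel {perm option bool} [set: {perm option bool}]%G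
  (sign_power (tperm a b)) _ _ _ _ (transitive_flat (option bool)) _ _ T_inf.
- by move=> x y _ _; apply: sign_powerM.
- by move=> x _; apply: finset.in_setT.
- by move=> x _; rewrite {1}/sign_power odd_sign_power.
- move=> x y _ _ /(sign_power_eq1 t_odd) x_even /(sign_power_eq1 t_odd) y_even.
  by apply: (@even_perm3C _ a b d) => // -[[]|].
- by move=> l [].
- by move=> l _ h i; apply: finset.in_setT.
- apply: (sub_finite_set _ (finite_involution_labellings tt t_odd sign_fin)).
  by move=> l [lF lE]; split=> // h i; have [] := lE h i.
move=> l0 [l1 [N [P [l0F l1F l01 l10 [lN P0 l0P]]]]].
apply: (uncountable_transitive l0F l1F l0F P0 l0P lN) => //.
move=> B B0 l0B l1B _.
have [h [i hi]] := labelling_neq l10.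
have [] := @even_perm3_closed _ a b d _ _ _ (l1 h i * (l0 h i)^-1) B _ _ _ _ => //.
- by case=> [[]|].
- by have [_ _ <-] := l01 h i; rewrite odd_permM odd_permV odd_sign_power // addbb.
- by rewrite -eq_mulgV1.
- by move=> w wB; rewrite permM; apply: perm_closedV (l0B h i) _ (l1B h i _ wB).
exact: cycle_option_bool.
Qed.

End Degree34.

(* Over the field with two elements every permutation of the plane is affine, so
   [linear_part] is a retraction of the symmetric group onto the stabilizer of the origin,
   and its kernel is the Klein group of translations. *)
Notation plane := (bool * bool)%type.
Notation origin := (false, false).

Definition addp (u v : plane) : plane := (u.1 (+) v.1, u.2 (+) v.2).

Lemma addpA : associative addp.
Proof. by move=> [? ?] [? ?] [? ?]; rewrite /addp /= !addbA. Qed.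

Lemma addpC : commutative addp.
Proof. by move=> [? ?] [? ?]; rewrite /addp /= addbC [X in (_, X)]addbC. Qed.

Lemma addpp u : addp u u = origin.
Proof. by rewrite /addp !addbb. Qed.

Lemma addp0 u : addp u origin = u.
Proof. by case: u => u1 u2; rewrite /addp !addbF. Qed.

Lemma addpK u : involutive (addp^~ u).
Proof. by move=> v; rewrite -addpA addpp addp0. Qed.

Lemma addp_cancel u v w : addp u w = addp v w -> u = v.
Proof. by move/(congr1 (addp^~ w)); rewrite !addpK. Qed.

Lemma plane_span (u v x y : plane) : u != origin -> v != origin -> u != v ->
  [|| y == x, y == addp x u, y == addp x v | y == addp (addp x u) v].
Proof. by move: u v x y => [[] []] [[] []] [[] []] [[] []]. Qed.

Lemma closed_translations (B : {set plane}) u v :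
    u != origin -> v != origin -> u != v -> B != finset.set0 ->
    {in B, forall x, addp x u \in B} -> {in B, forall x, addp x v \in B} ->
  B = [set: plane]%SET.
Proof.
move=> u0 v0 uv /set0Pn[x xB] uB vB; apply/setP => y; rewrite finset.in_setT.
by case/or4P: (plane_span x y u0 v0 uv) => /eqP->; rewrite ?uB ?vB ?uB.
Qed.

Lemma addp_uniq4 (p q r s : plane) :
  uniq [:: p; q; r; s] -> s = addp (addp p q) r.
Proof. by move: p q r s => [[] []] [[] []] [[] []] [[] []]. Qed.

(** In general position [u], [v], [origin] and [addp u v] fill the plane; so do their images, which
    therefore add up to zero. *)
Lemma perm_affine (x : {perm plane}) u v :
  x (addp u v) = addp (addp (x u) (x v)) (x origin).
Proof.
have [->|u0] := eqVneq u origin; first by rewrite addpC addp0 [addp (x _) _]addpC addpK.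
have [->|v0] := eqVneq v origin; first by rewrite addp0 addpK.
have [->|uv] := eqVneq u v; first by rewrite !addpp addpC addp0.
apply: addp_uniq4; rewrite -[uniq _]/(uniq (map x [:: u; v; origin; addp u v])).
rewrite (map_inj_uniq perm_inj).
by move: u v u0 v0 uv => [[] []] [[] []].
Qed.

Definition translation u : {perm plane} := perm (can_inj (addpK u)).

Lemma translationE u v : translation u v = addp v u.
Proof. by rewrite permE. Qed.

Lemma linear_part_inj (x : {perm plane}) : injective (fun v => addp (x v) (x origin)).
Proof. by move=> u v /addp_cancel/perm_inj. Qed.

Definition linear_part (x : {perm plane}) : {perm plane} := perm (@linear_part_inj x).

Lemma linear_partE x v : linear_part x v = addp (x v) (x origin).
Proof. by rewrite permE. Qed.

Lemma linear_partM : {morph linear_part : x y / x * y}.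
Proof.
move=> x y; apply/permP => v; rewrite permM !linear_partE !permM perm_affine.
by rewrite addpK.
Qed.

Lemma linear_part_origin x : linear_part x origin = origin.
Proof. by rewrite linear_partE addpp. Qed.

Lemma linear_part_eq1 x : linear_part x = 1 -> x = translation (x origin).
Proof.
move=> x1; apply/permP => v; rewrite translationE -[in RHS](perm1 v) -x1 linear_partE.
by rewrite addpK.
Qed.

Lemma translationC u v : commute (translation u) (translation v).
Proof.
by apply/permP => w; rewrite !permM !translationE -!addpA (addpC u).
Qed.

Lemma translation_conj (g : {perm plane}) u :
  g origin = origin -> translation u ^ g = translation (g u).
Proof.
move=> g0; apply/permP => w; rewrite conjgE !permM !translationE perm_affine g0 addp0.
by rewrite permKV.
Qed.

Lemma translation2 u : translation u * translation u = 1.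
Proof. by apply/permP => w; rewrite permM !translationE addpK perm1. Qed.

(** * Degree four *)

Section Degree4.
Variables (m : nat) (c : 'I_m -> int) (rel : seq (word 'I_m)).
Local Notation flat := (@flat m c rel _).
Local Notation transitive_flat := (transitive_flat c rel).
Local Notation flat_sign := (flat_sign c rel).

Definition conj_labelling (gT : finGroupType) (g : gT) (l : labelling m gT) :
    labelling m gT :=
  fun h => [ffun i => l h i ^ g].

Lemma flat_conj (gT : finGroupType) (g : gT) (l : labelling m gT) :
  flat l -> flat (conj_labelling g l).
Proof.
apply: (flat_morph (D := [set: gT]%G) (f := conjgm_morphism [set: gT]%G g)).
  by move=> h i; apply: finset.in_setT.
by move=> h i; rewrite ffunE /= conjgmE.
Qed.

(** The stabilizer of the origin is a copy of [S_3] and the image of [linear_part]. *)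
Definition flat_origin : set (labelling m {perm plane}) :=
  [set l : labelling m {perm plane} | flat l /\ forall h i, l h i origin = origin].

(** Inside the stabilizer of the origin, [l1] differs from [l0] by a 3-cycle of [a], [b], [d].
    Conjugation by a transposition turns it into a 3-cycle of [a], [b], [origin], and the two
    together are transitive. *)
Lemma flat_origin_uncountable :
  finite_set flat_sign -> infinite_set flat_origin -> ~ countable (transitive_flat plane).
Proof.
move=> sign_fin inf.
pose a : plane := (true, false); pose b : plane := (false, true).
pose d : plane := (true, true).
pose H : {group {perm plane}} := 'C[origin | 'P]%G.
have HP (x : {perm plane}) : reflect (x origin = origin) (x \in H) by apply: (iffP astab1P).
have t_odd : odd_perm (tperm a b) by rewrite odd_tperm.
have tt : tperm a b * tperm a b = 1 := tperm2 a b.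
have [] := @flat_homoclinic m c rel {perm plane} H
  (sign_power (tperm a b)) _ _ _ _ flat_origin _ _ inf.
- by move=> x y _ _; apply: sign_powerM.
- by move=> x _; apply/HP; rewrite /sign_power; case: ifP; rewrite ?perm1 // permE.
- by move=> x _; rewrite {1}/sign_power odd_sign_power.
- move=> x y /HP x0 /HP y0 /(sign_power_eq1 t_odd) x_even /(sign_power_eq1 t_odd) y_even.
  by apply: (@even_perm3C _ a b d) => // -[[] []].
- by move=> l [].
- by move=> l [_ l0] h i; apply/HP.
- apply: (sub_finite_set _ (finite_involution_labellings tt t_odd sign_fin)).
  by move=> l [lF lE]; split=> // h i; have [] := lE h i.
move=> l0 [l1 [N [P [l0F l1F l01 l10 [lN P0 l0P]]]]].
(* [g] commutes with [tperm a b], the only nontrivial label that [l0] can take, so conjugation by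
   [g] preserves the background. *)
pose g : {perm plane} := tperm origin d.
have l0g h i : l0 h i ^ g = l0 h i.
  have [_ _ <-] := l01 h i; rewrite /sign_power; case: ifP => _; last by rewrite conj1g.
  by rewrite tpermJ !permE.
have [h [i hi]] := labelling_neq l10.
pose z := l1 h i * (l0 h i)^-1.
have z1 : z != 1 by rewrite -eq_mulgV1.
have z_even : ~~ odd_perm z.
  rewrite /z; have [_ _ <-] := l01 h i.
  by rewrite odd_permM odd_permV odd_sign_power // addbb.
have z_fix w : w != a -> w != b -> w != d -> z w = w.
  have [/HP l0O /HP l1O _] := l01 h i.
  case: w => [[] []] // _ _ _.
  by rewrite /z permM l1O -{1}l0O permK.
have zcl := @even_perm3_closed _ a b d isT isT isT z _ z_fix z_even z1.
apply: (uncountable_transitive (l2 := conj_labelling g l1) l0F l1F _ P0 l0P lN).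
- exact: flat_conj.
- by move=> w wN; apply/ffunP => j; rewrite ffunE lN // l0g.
(* If conjugation by [g] preserved [l1], then [l1 h i], which fixes the origin, would also fix [d],
   and so would the 3-cycle [z]. *)
- move=> E; have zd : z d = d.
    have [/HP l0O /HP l1O l01hi] := l01 h i.
    have := congr1 (fun f : labelling m {perm plane} => f h i d) E.
    rewrite ffunE conjgE !permM tpermV tpermR l1O tpermL => l1d.
    rewrite l1d; apply: (@perm_inj _ (l0 h i)); rewrite permKV -l01hi.
    by rewrite /sign_power; case: ifP; rewrite ?perm1 // permE.
  have zdB : {in [set d]%SET, forall w, z w \in [set d]%SET}.
    by move=> w; rewrite !inE => /eqP->; rewrite zd.
  by have [_ _] := zcl _ zdB; rewrite !inE => /(_ isT).
move=> B B0 l0B l1B l2B.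
have zB : {in B, forall w, z w \in B}.
  by move=> w wB; rewrite /z permM; apply: perm_closedV (l0B h i) _ (l1B h i _ wB).
(* Closure of [B] under the conjugate of [z] is closure of its image by [g] under [z], to which
   [zcl] applies. *)
have zgB : {in [set g w | w in B]%SET, forall w, z w \in [set g w | w in B]%SET}.
  move=> _ /imsetP[w wB ->]; apply/imsetP.
  exists ((z ^ g) w); last first.
    rewrite -!permM conjgE (tpermV _ _ : g^-1 = g) -!mulgA.
    by rewrite (tperm2 _ _ : g * g = 1) mulg1.
  rewrite /z conjMg conjVg l0g permM; apply: perm_closedV (l0B h i) _ _.
  by have := l2B h i _ wB; rewrite ffunE.
have [ab bd da] := zcl _ zB; have [ab' bd' da'] := zcl _ zgB.
have gB w : (g w \in [set g w | w in B]%SET) = (w \in B).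
  by rewrite mem_imset //; exact: perm_inj.
have ga : g a = a by rewrite permE.
have gb : g b = b by rewrite permE.
have gd : g origin = d by rewrite permE.
rewrite -{1}ga -{1}gb !gB in ab'; rewrite -{1}gb -{1}gd !gB in bd'.
rewrite -{1}gd -{1}ga !gB in da'.
have /set0Pn[x xB] := B0.
have aB : a \in B.
  by case: x xB => [[] []] xB //; [apply: da | apply/da/bd | apply: da'].
have bB : b \in B := ab aB.
by apply/setP => -[[] []]; rewrite finset.in_setT //; [apply: bd | apply: bd'].
Qed.

(** Taking the quotient is multiplicative on the pairs whose quotient is a power of [T] and whose
    second component commutes with [T]. *)
Lemma flat_quotient (gT : finGroupType) (T : gT) (x y : labelling m gT) :
    (forall h i, x h i * (y h i)^-1 \in <[T]>) -> (forall h i, commute T (y h i)) ->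
    flat x -> flat y ->
  flat (fun h => [ffun i => x h i * (y h i)^-1]).
Proof.
move=> xyT yT xF yF.
pose D := [set t : gT * gT | (t.1 * t.2^-1 \in <[T]>) && (T * t.2 == t.2 * T)]%SET.
pose f (t : gT * gT) := t.1 * t.2^-1.
have DP (t : gT * gT) : reflect (f t \in <[T]> /\ commute T t.2) (t \in D).
  by rewrite inE; apply: (iffP andP) => -[tT /eqP].
have fM : {in D &, {morph f : t u / t * u}}.
  move=> t u /DP[_ tC] /DP[/cycleP[n uT] _]; rewrite /f in uT *.
  rewrite /= invMg !mulgA -(mulgA t.1) uT -!mulgA; congr (_ * _); rewrite uT.
  exact/commute_sym/commuteX/commute_sym/commuteV.
have D_group : group_set D.
  apply/group_setP; split.
    by apply/DP; rewrite /f /= invg1 mulg1; split=> //; apply: commute1.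
  move=> t u tD uD; apply/DP; rewrite fM //; case/DP: tD uD => [tT tC] /DP[uT uC].
  by split; [apply: groupM | apply: (commuteM tC uC)].
apply: (flat_morph (D := Group D_group) (f := @Morphism _ _ (Group D_group) f fM)
  (l := pair_labelling x y)).
- by move=> h i; apply/DP; rewrite /f ffunE; split; [apply: xyT | apply: yT].
- by move=> h i; rewrite !ffunE.
- exact: flat_pair.
Qed.

(** The retractions are tried from the bottom up. Infinitely many sign labellings are handled by two
    translations, infinitely many labellings in the stabilizer of the origin by the previous case,
    and what remains by [linear_part]. *)
Lemma transitive_flat4 :
  finite_set (transitive_flat plane) \/ ~ countable (transitive_flat plane).
Proof.
apply: contrapT => /not_orP[T_inf]; apply.
have [sign_fin|sign_inf] := pselect (finite_set flat_sign); last first.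
  apply: (flat_sign_uncountable (v := translation (true, false))
    (v' := translation (false, true))) sign_inf; try exact: translation2.
  - by apply/eqP => /permP/(_ origin); rewrite !translationE.
  - move=> B B0 vB v'B.
    apply: (@closed_translations B (true, false) (false, true)) => // x xB.
      by rewrite -translationE vB.
    by rewrite -translationE v'B.
have [origin_fin|] := pselect (finite_set flat_origin); last first.
  exact: flat_origin_uncountable.
have [] := @flat_homoclinic m c rel {perm plane} [set: {perm plane}]%G
  linear_part _ _ _ _ (transitive_flat plane) _ _ T_inf.
- by move=> x y _ _; apply: linear_partM.
- by move=> x _; apply: finset.in_setT.
- by move=> x _; apply/permP => v; rewrite linear_partE linear_part_origin addp0.
- by move=> x y _ _ /linear_part_eq1-> /linear_part_eq1->; apply: translationC.
- by move=> l [].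
- by move=> l _ h i; apply: finset.in_setT.
- apply: (sub_finite_set _ origin_fin) => l [lF lE]; split=> // h i.
  by have [_ <-] := lE h i; apply: linear_part_origin.
move=> l0 [l1 [N [P [l0F l1F l01 l10 [lN P0 l0P]]]]].
have l0O h i : l0 h i origin = origin.
  by have [_ _ <-] := l01 h i; apply: linear_part_origin.
have l0V h i : (l0 h i)^-1 origin = origin by rewrite -{1}(l0O h i) permK.
pose z h i := l1 h i * (l0 h i)^-1.
pose t h i := z h i origin.
have zE h i : z h i = translation (t h i).
  apply: linear_part_eq1; rewrite /z linear_partM; have [_ _ ->] := l01 h i.
  apply/permP => v; rewrite permM linear_partE perm1.
  by rewrite permK l0V addp0.
have [tr|] := pselect (forall B : {set plane}, B != finset.set0 -> stable l0 B ->
    stable l1 B -> B = [set: plane]%SET).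
  by apply: (uncountable_transitive l0F l1F l0F P0 l0P lN) => // B B0 l0B l1B _; apply: tr.
move=> /existsNP[B /not_implyP[B0 /not_implyP[l0B /not_implyP[l1B BT]]]].
have [h [i hi]] := labelling_neq l10.
have t0 : t h i != origin.
  apply: contra hi => /eqP tO; rewrite -(mulgKV (l0 h i) (l1 h i)) -/(z h i) zE tO.
  by apply/eqP/permP => v; rewrite permM translationE addp0.
(* The proper set [B] is only stable under the translation by [t h i], so the cocycle [z]
   has order two and commutes with [l0]; hence it is itself a flat labelling. *)
have B_translation u : {in B, forall w, addp w u \in B} -> u = origin \/ u = t h i.
  move=> uB; have [|u0] := eqVneq u origin; first by left.
  have [|ut] := eqVneq u (t h i); first by right.
  case: BT; apply: closed_translations u0 t0 ut B0 uB _ => w wB.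
  rewrite -translationE -zE permM; apply: perm_closedV (l0B h i) _ _; exact: l1B.
have zB g j : {in B, forall w, z g j w \in B}.
  by move=> w wB; rewrite permM; apply: perm_closedV (l0B g j) _ (l1B g j _ wB).
have t_val g j : t g j = origin \/ t g j = t h i.
  by apply: B_translation => w wB; rewrite -translationE -zE zB.
(* Conjugating [z h i] by [l0 g j] gives the translation by [l0 g j (t h i)], which preserves [B]
   too. *)
have l0t g j : l0 g j (t h i) = t h i.
  case: (@B_translation (l0 g j (t h i))) => // [w wB|].
    rewrite -translationE -translation_conj // -zE conjgE permM (permM (z h i)).
    by apply: (l0B); apply: zB; apply: perm_closedV (l0B g j) _ wB.
  by rewrite -(l0O g j) => /perm_inj tO; rewrite tO eqxx in t0.
pose T := translation (t h i).
pose zl : labelling m {perm plane} := fun h => [ffun i => l1 h i * (l0 h i)^-1].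
have zlF : flat zl.
  apply: (@flat_quotient _ T) => // g j; last first.
    by apply/commgP/conjg_fixP; rewrite /T translation_conj ?l0t.
  rewrite -/(z g j) zE; case: (t_val g j) => ->; last exact: cycle_id.
  suff -> : translation origin = 1 by apply: group1.
  by apply/permP => w; rewrite translationE addp0 perm1.
(* A vector independent of [t h i]. Swapping the two fixes the origin, so it conjugates [T] into the
   translation by [u]. *)
have [u u0 ut] : exists2 u : plane, u != origin & t h i != u.
  by case: (t h i) => [[] []]; [exists (true, false)|exists (false, true)|
    exists (true, false)|exists (true, true)].
pose g := tperm (t h i) u.
have Tg : T ^ g = translation u.
  rewrite /T translation_conj; last by rewrite tpermD.
  by rewrite tpermL.
have zlN w : (N < `|w|)%N -> zl w = trivial_labelling m _ w.
  by move=> wN; apply/ffunP => j; rewrite !ffunE lN // mulgV.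
have zlhi : zl h i = T by rewrite ffunE -/(z h i) zE.
(* The background is now trivial, and the two perturbations contain translations by independent
   vectors. *)
apply: (uncountable_transitive (l2 := conj_labelling g zl) (P := 1)
  (flat_trivial c _) zlF (flat_conj _ zlF) _ _ zlN) => //.
- by move=> w /zlN wN; apply/ffunP => j; rewrite ffunE wN ffunE conj1g.
- move/(congr1 (fun f : labelling m {perm plane} => f h i origin)).
  rewrite zlhi ffunE zlhi Tg !translationE addpC addp0 addpC addp0 => tu.
  by rewrite tu eqxx in ut.
move=> C C0 _ zC gC; apply: closed_translations t0 u0 ut C0 _ _ => w wC.
  by rewrite -translationE -/T -zlhi zC.
by rewrite -translationE -Tg -zlhi; have := gC h i w wC; rewrite ffunE.
Qed.

End Degree4.

(** * Subgroups of finite index *)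

Lemma card_setT_finType (X : finType) : ([set: X] #= `I_#|X|)%card.
Proof.
have rank_inj : {in [set: X] &, injective (@enum_rank X)}.
  by move=> x y _ _; apply: enum_rank_inj.
have := inj_card_eq rank_inj; rewrite card_eq_sym => /card_eq_trans; apply.
rewrite (_ : _ @` _ = [set: 'I_#|X|]); last first.
  by apply/seteqP; split=> // i _; exists (enum_val i) => //; apply: enum_valK.
by rewrite card_eq_sym card_II.
Qed.

Lemma multiplicative1 (A B : groupType) (g : {multiplicative A -> B}) : g 1 = 1.
Proof. by apply: (mulgI (g 1)); rewrite -gmulfM !mulg1. Qed.

Lemma multiplicativeV (A B : groupType) (g : {multiplicative A -> B}) :
  {morph g : x / x^-1}.
Proof. by move=> x; apply: (mulgI (g x)); rewrite -gmulfM !mulgV multiplicative1. Qed.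

Local Notation repr := generic_quotient.repr.

(** * Labellings as homomorphisms from the kernel *)

Section Correspondence.
Variables (K G : groupType) (chi : {multiplicative G -> Algebra.to_multiplicative int}).
Variables (iota : {multiplicative K -> G}) (m : nat) (R : set (free_group 'I_m)).
Variable f : {multiplicative free_group 'I_m -> G}.
Hypotheses (f_surj : range f = [set: G])
  (f_ker : Defs.ker f = normal_closure R)
  (iota_inj : injective iota) (iota_range : range iota = Defs.ker chi).

Definition word_value (w : word 'I_m) : G := f (\pi_(free_group 'I_m) w).
Local Notation val := word_value.
Definition gen_height (i : 'I_m) : int := chi (val [:: (i, true)]).
Local Notation c := gen_height.
Definition deg (g : G) : int := chi g.

Lemma degM g g' : deg (g * g') = (deg g + deg g')%R.
Proof. by rewrite /deg gmulfM. Qed.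

Lemma deg1 : deg 1 = 0%R.
Proof. exact: (multiplicative1 chi). Qed.

Lemma degV g : deg g^-1 = (- deg g)%R.
Proof. exact: (multiplicativeV chi). Qed.

Lemma word_value_cat u v : val (u ++ v) = val u * val v.
Proof. by rewrite /val -free_mulE gmulfM. Qed.

Lemma word_value_inv u : val (word_inv u) = (val u)^-1.
Proof. by rewrite /val -free_invE -multiplicativeV. Qed.

Lemma word_value_nil : val [::] = 1.
Proof. exact: (multiplicative1 f). Qed.

Lemma deg_word_value w : deg (val w) = height c w.
Proof.
elim: w => [|[i b] w IHw]; first by rewrite word_value_nil deg1.
rewrite -cat1s word_value_cat degM IHw height_cat /= GRing.addr0; congr (_ + _)%R.
case: b => //; rewrite /letter_height /= -degV -word_value_inv; congr (deg (val _)).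
Qed.

Lemma word_value_surj g : exists w, val w = g.
Proof.
have : range f g by rewrite f_surj.
by case=> a _ <-; elim/free_group_ind: a => u; exists u.
Qed.

Variables (s : seq (free_group 'I_m)) (wx : word 'I_m).
Hypotheses (RE : forall a, R a <-> a \in s) (wx_deg : deg (val wx) = 1%R).

(* Requiring [wx], which has degree 1, to evaluate to 1 makes the labelling attached to a
   homomorphism [K -> gT] unique. *)
Definition relators : seq (word 'I_m) := wx :: [seq repr a | a <- s].
Local Notation flat := (@flat m c relators _).

Lemma f_normal_closure a : normal_closure R a -> f a = 1.
Proof. by rewrite -f_ker. Qed.

Lemma normal_closure_sub a : R a -> normal_closure R a.
Proof. by move=> Ra N [_]; apply. Qed.

Lemma val_repr a : val (repr a) = f a.
Proof. by rewrite /val reprK. Qed.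

Lemma eval_repr_mul (gT : finGroupType) (l : labelling m gT) h (a b : free_group 'I_m) :
  eval c l h (repr (a * b)) =
  eval c l h (repr a) * eval c l (h + deg (f a))%R (repr b).
Proof.
rewrite (eval_free_eq c l h (free_repr (repr a ++ repr b))) eval_cat.
by rewrite -deg_word_value val_repr.
Qed.

Lemma eval_repr_inv (gT : finGroupType) (l : labelling m gT) h (a : free_group 'I_m) :
  eval c l h (repr a^-1) = (eval c l (h - deg (f a))%R (repr a))^-1.
Proof.
rewrite (eval_free_eq c l h (free_repr (word_inv (repr a)))) eval_inv.
by rewrite -deg_word_value val_repr.
Qed.

(** The elements of the kernel of [f] whose words evaluate to 1 from every vertex form a normal
    subgroup containing [R]; lying in the kernel makes their walks closed. *)
Lemma flat_normal_closure (gT : finGroupType) (l : labelling m gT) h (a : free_group 'I_m) :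
  flat l -> normal_closure R a -> eval c l h (repr a) = 1.
Proof.
move=> lF aR; pose N := [set b | f b = 1 /\ forall h, eval c l h (repr b) = 1].
suff [_] : N a by apply.
apply: aR; split; last first.
  move=> b Rb; split; first by apply: f_normal_closure; apply: normal_closure_sub.
  move=> h'; apply: lF; rewrite in_cons; apply/orP; right; apply: map_f.
  exact/RE.
have NV b : N b -> N b^-1.
  move=> [fb bE]; split=> [|h']; first by rewrite multiplicativeV fb invg1.
  by rewrite eval_repr_inv bE invg1.
have NM b b' : N b -> N b' -> N (b * b').
  move=> [fb bE] [fb' bE']; split=> [|h']; first by rewrite gmulfM fb fb' mulg1.
  by rewrite eval_repr_mul bE bE' mulg1.
split; first split.
- rewrite inE; split=> [|h']; first exact: multiplicative1.
  by rewrite (eval_free_eq c l h' (free_repr [::])).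
- by move=> b b'; rewrite !inE => bN /NV; apply: NM.
move=> b g [fb bE]; split=> [|h'].
  by rewrite conjgE !gmulfM fb mul1g -gmulfM mulVg multiplicative1.
rewrite conjgE !eval_repr_mul bE mul1g fb deg1 GRing.addr0 eval_repr_inv.
by rewrite multiplicativeV degV mulVg.
Qed.

(** The presentation of [G] enters here: [u] followed by the inverse of [v] represents an element of
    the normal closure of [R]. *)
Lemma eval_val (gT : finGroupType) (l : labelling m gT) h u v :
  flat l -> val u = val v -> eval c l h u = eval c l h v.
Proof.
move=> lF uv; pose a := \pi_(free_group 'I_m) (u ++ word_inv v).
have fa : f a = 1 by rewrite -[f a]/(val _) word_value_cat word_value_inv uv mulgV.
have aR : normal_closure R a by rewrite -f_ker.
have := flat_normal_closure h lF aR; rewrite (eval_free_eq c l h (free_repr _)).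
rewrite eval_cat eval_inv -!deg_word_value uv GRing.addrK => /eqP.
by rewrite -eq_mulgV1 => /eqP.
Qed.

Definition word_of g : word 'I_m := sval (cid (word_value_surj g)).

Lemma word_ofK g : val (word_of g) = g.
Proof. exact: svalP (cid (word_value_surj g)). Qed.

Definition transport (gT : finGroupType) (l : labelling m gT) h g :=
  eval c l h (word_of g).

Lemma transportE (gT : finGroupType) (l : labelling m gT) h u :
  flat l -> transport l h (val u) = eval c l h u.
Proof. by move=> lF; apply: eval_val; rewrite ?word_ofK. Qed.

Lemma transportM (gT : finGroupType) (l : labelling m gT) h g g' : flat l ->
  transport l h (g * g') = transport l h g * transport l (h + deg g)%R g'.
Proof.
move=> lF; rewrite -{1}(word_ofK g) -{1}(word_ofK g') -word_value_cat transportE //.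
by rewrite eval_cat -deg_word_value word_ofK.
Qed.

Lemma transport1 (gT : finGroupType) (l : labelling m gT) h : flat l -> transport l h 1 = 1.
Proof. by move=> lF; rewrite -word_value_nil transportE. Qed.

Local Notation x := (val wx).

Definition lift (h : int) : G := match h with Posz n => x ^+ n | Negz n => x ^- n.+1 end.

Lemma lift0 : lift 0 = 1. Proof. by []. Qed.

Lemma liftS h : lift (h + 1)%R = lift h * x.
Proof.
case: h => [n|[|n]] /=; first by rewrite addn1 expgSr.
  by rewrite expg1 mulVg.
by rewrite subn1 /= [in RHS]expgS invMg mulgKV.
Qed.

Lemma lift_ind (Q : int -> Prop) :
  Q 0%R -> (forall h, Q h <-> Q (h + 1)%R) -> forall h, Q h.
Proof.
move=> Q0 QS; case=> n.
  by elim: n => // n IHn; have := (QS n).1 IHn; rewrite -addn1 PoszD.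
elim: n => [|n IHn]; first by apply/QS.
by apply/QS; rewrite (_ : (_ + 1)%R = Negz n) //; lia.
Qed.

Lemma deg_lift h : deg (lift h) = h.
Proof.
elim/lift_ind: h => [|h]; first by rewrite lift0 deg1.
by rewrite liftS degM wx_deg; split=> [->//|]; lia.
Qed.

(** Each step along the powers of [x] spells [wx], which is one of the relators. *)
Lemma transport_lift (gT : finGroupType) (l : labelling m gT) h :
  flat l -> transport l 0%R (lift h) = 1.
Proof.
move=> lF; elim/lift_ind: h => [|h]; first by rewrite lift0 transport1.
rewrite liftS transportM // deg_lift GRing.add0r transportE // (lF h wx) ?mulg1 //.
by rewrite in_cons eqxx.
Qed.

(** For [g] the value of a generator, this is a Schreier generator of the kernel with respect to the
    transversal of powers of [x]. *)
Definition loop h g := lift h * g * (lift (h + deg g)%R)^-1.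

Lemma deg_loop h g : deg (loop h g) = 0%R.
Proof. by rewrite /loop !degM degV !deg_lift; lia. Qed.

Lemma loopM h g g' : loop h (g * g') = loop h g * loop (h + deg g)%R g'.
Proof. by rewrite /loop degM -!mulgA mulKg GRing.addrA. Qed.

Lemma transport_loop (gT : finGroupType) (l : labelling m gT) h g :
  flat l -> transport l 0%R (loop h g) = transport l h g.
Proof.
move=> lF; have := transportM 0%R (loop h g) (lift (h + deg g)%R) lF.
rewrite deg_loop GRing.addr0 transport_lift // mulg1 => <-.
rewrite /loop mulgKV transportM //.
by rewrite transport_lift // mul1g deg_lift GRing.add0r.
Qed.

Lemma deg_iota k : deg (iota k) = 0%R.
Proof. by have : range iota (iota k) by []; rewrite iota_range. Qed.

Lemma iota_surj g : exists k, deg g = 0%R -> iota k = g.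
Proof.
have [g0|g0] := pselect (deg g = 0%R); last by exists 1.
have : range iota g by rewrite iota_range.
by case=> k _ <-; exists k.
Qed.

(** The inverse of [iota] on the kernel of [chi], with arbitrary values elsewhere. *)
Definition coiota g : K := sval (cid (iota_surj g)).

Lemma coiotaK g : deg g = 0%R -> iota (coiota g) = g.
Proof. exact: svalP (cid (iota_surj g)). Qed.

Lemma iotaK k : coiota (iota k) = k.
Proof. by apply: iota_inj; rewrite coiotaK ?deg_iota. Qed.

Lemma coiotaM g g' : deg g = 0%R -> deg g' = 0%R -> coiota (g * g') = coiota g * coiota g'.
Proof.
move=> g0 g'0; apply: iota_inj.
by rewrite gmulfM !coiotaK // degM g0 g'0.
Qed.

Definition monodromy (gT : finGroupType) (l : labelling m gT) k : gT :=
  transport l 0%R (iota k).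

Lemma monodromyM (gT : finGroupType) (l : labelling m gT) k k' : flat l ->
  monodromy l (k * k') = monodromy l k * monodromy l k'.
Proof. by move=> lF; rewrite /monodromy gmulfM transportM // deg_iota GRing.addr0. Qed.

Lemma monodromy1 (gT : finGroupType) (l : labelling m gT) : flat l -> monodromy l 1 = 1.
Proof. by move=> lF; rewrite /monodromy multiplicative1 transport1. Qed.

Lemma monodromyV (gT : finGroupType) (l : labelling m gT) k : flat l ->
  monodromy l k^-1 = (monodromy l k)^-1.
Proof.
by move=> lF; apply: (mulIg (monodromy l k)); rewrite -monodromyM // !mulVg monodromy1.
Qed.

(** Labels are the values of the homomorphism on Schreier generators, so it determines the
    labelling. *)
Lemma monodromy_label (gT : finGroupType) (l : labelling m gT) h i : flat l ->
  monodromy l (coiota (loop h (val [:: (i, true)]))) = l h i.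
Proof.
move=> lF; rewrite /monodromy coiotaK ?deg_loop // transport_loop // transportE //=.
by rewrite mulg1.
Qed.

Section Action.
Variable X : finType.
Implicit Types (l : labelling m {perm X}) (p y : X).
Local Notation transitive_flat := (transitive_flat c relators X).

Definition monodromy_stabilizer l p : set K := [set k | monodromy l k p = p].

Lemma monodromy_transitive l p y : transitive_flat l -> exists k, monodromy l k p = y.
Proof.
move=> [lF lT]; pose B := [set z | `[< exists k, monodromy l k p = z >]]%SET.
suff : y \in B by rewrite inE => /asboolP.
rewrite (lT B) ?finset.in_setT //.
  apply/set0Pn; exists p; rewrite inE; apply/asboolP; exists 1.
  by rewrite monodromy1 ?perm1.
move=> h i z; rewrite inE => /asboolP[k <-]; rewrite inE; apply/asboolP.
exists (k * coiota (loop h (val [:: (i, true)]))).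
by rewrite monodromyM // permM monodromy_label.
Qed.

Lemma monodromy_stabilizer_index l p :
  transitive_flat l -> subgroups_of_index K #|X| (monodromy_stabilizer l p).
Proof.
move=> lT; have [lF _] := lT.
have stabV k : monodromy l k p = p -> monodromy l k^-1 p = p.
  by move=> kp; rewrite monodromyV // -{1}kp permK.
split.
  split; first by rewrite inE /monodromy_stabilizer /= monodromy1 ?perm1.
  move=> u v; rewrite !inE /monodromy_stabilizer /= => up vp.
  by rewrite monodromyM // permM up stabV.
(* Permutations compose from left to right, so [K] acts on the right, and left cosets correspond to
   points through inverses. *)
pose F y : set K := [set k | monodromy l k^-1 p = y].
have cosetE a : [set a * h | h in monodromy_stabilizer l p] = F (monodromy l a^-1 p).
  apply/seteqP; split=> [_ [h hp <-]|k]; rewrite /F /=.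
    by rewrite invMg monodromyM // permM (stabV h hp).
  move=> kp; exists (a^-1 * k); last by rewrite mulKVg.
  by rewrite /monodromy_stabilizer /= monodromyM // permM -kp monodromyV // permKV.
have F_inj : {in [set: X] &, injective F}.
  move=> y y' _ _ Fyy'; have [k kp] := monodromy_transitive p y lT.
  have : F y k^-1 by rewrite /F /= invgK.
  by rewrite Fyy' /F /= invgK kp.
rewrite /has_index; have -> : left_cosets (monodromy_stabilizer l p) = F @` [set: X].
  apply/seteqP; split=> [_ [a _ <-]|_ [y _ <-]].
    by rewrite cosetE; exists (monodromy l a^-1 p).
  have [k kp] := monodromy_transitive p y lT.
  by exists k^-1 => //; rewrite cosetE invgK kp.
apply: card_eq_trans (inj_card_eq F_inj) _.
exact: card_setT_finType.
Qed.

Lemma monodromy_inj l l' : flat l -> flat l' ->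
  (forall k, monodromy l k = monodromy l' k) -> l = l'.
Proof.
move=> lF l'F E; apply/funext => h; apply/ffunP => i.
by rewrite -!monodromy_label.
Qed.

(* A labelling is determined by the stabilizer of [p] and the images of [p] under finitely
   many coset representatives. *)
Lemma countable_monodromy_fiber p (H : set K) :
  countable [set l | transitive_flat l /\ monodromy_stabilizer l p = H].
Proof.
set A := [set l | _].
have [[l1 [l1T l1H]]|noL] := pselect (exists l, A l); last first.
  rewrite (_ : A = classical_sets.set0) ?countable0 //.
  by apply/seteqP; split=> // l lH; case: noL; exists l.
have /choice[r rP] y : exists k, monodromy l1 k^-1 p = y.
  by have [k kp] := monodromy_transitive p y l1T; exists k^-1; rewrite invgK.
pose data l : {ffun X -> X} := [ffun y => monodromy l (r y)^-1 p].
suff data_inj : {in A &, injective data}.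
  have := finite_set_countable (@finite_finset _ (data @` A)).
  by rewrite (eq_countable (inj_card_eq data_inj)).
move=> l l' /set_mem[lT lH] /set_mem[l'T l'H] /ffunP ll'.
have [[[l1F _] [lF _]] [l'F _]] := (l1T, lT, l'T).
(* [k] is an element of [H], which fixes [p] for both labellings, times [(r y)^-1], on which the
   data agree. *)
have same k : monodromy l k p = monodromy l' k p.
  pose y := monodromy l1 k p; pose h := (r y)^-1 * k^-1.
  have kE : k = h^-1 * (r y)^-1 by rewrite invMg !invgK mulgK.
  have hH : H h^-1.
    rewrite -l1H /monodromy_stabilizer /= invMg !invgK monodromyM // permM -/y.
    by apply: (@perm_inj _ (monodromy l1 (r y))^-1); rewrite permK -monodromyV // rP.
  have := ll' y; rewrite !ffunE => E; rewrite kE !monodromyM // !permM.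
  by move: (hH) (hH); rewrite -{1}lH -l'H => -> ->.
apply: monodromy_inj => // k; apply/permP => y.
have [k' <-] := monodromy_transitive p y lT.
by rewrite [in RHS]same -!permM -!monodromyM // same.
Qed.

Lemma stable_monodromy l (B : {set X}) k y :
  stable l B -> y \in B -> monodromy l k y \in B.
Proof.
rewrite /monodromy /transport => lB.
elim: (word_of _) 0%R y => [|[i b] w IHw] h y yB; first by rewrite perm1.
rewrite permM; apply: IHw; rewrite /letter_eval /=; case: b; first exact: lB.
exact: perm_closedV (lB _ _) _ yB.
Qed.

(** The action of [K] on the cosets of [H], evaluated on Schreier generators, is a flat
    labelling. *)
Lemma subgroup_monodromy (H : set K) : subgroups_of_index K #|X| H ->
  exists l p, transitive_flat l /\ H = monodromy_stabilizer l p.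
Proof.
move=> [[H1 HV] H_index].
have H_in k : (k \in H) <-> H k by rewrite inE.
have {}H1 : H 1 by apply/H_in.
have {}HV a b : H a -> H b -> H (a * b^-1) by rewrite -!H_in; apply: HV.
have HV1 a : H a -> H a^-1 by move=> Ha; rewrite -(mul1g a^-1); apply: HV.
have HM a b : H a -> H b -> H (a * b).
  by move=> Ha /HV1 Hb; rewrite -[b]invgK; apply: HV.
pose lcoset (a : K) : set K := [set a * h | h in H].
have mem_lcoset a k : lcoset a k <-> H (a^-1 * k).
  split=> [[h Hh <-]|Hk]; first by rewrite mulKg.
  by exists (a^-1 * k) => //; rewrite mulKVg.
have [F [F_fun F_inj F_surj]] : exists F, set_bij [set: X] (left_cosets H) F.
  apply/card_set_bijP; apply: card_eq_trans (card_setT_finType X) _.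
  by rewrite card_eq_sym.
have F_coset y : exists a, F y = lcoset a.
  by have [a _ <-] := F_fun y I; exists a.
have coset_F a : exists y, F y = lcoset a.
  by have [|y _ <-] := F_surj (lcoset a); [exists a | exists y].
have {}F_inj y y' : F y = F y' -> y = y' by apply: F_inj; rewrite inE.
have act_ex (k : K) (y : X) : exists y', F y' = [set k^-1 * z | z in F y].
  have [a Fa] := F_coset y; have [y' Fy'] := coset_F (k^-1 * a); exists y'.
  rewrite Fy' Fa; apply/seteqP; split=> [_ [h Hh <-]|_ [_ [h Hh <-] <-]].
    by exists (a * h); [exists h | rewrite mulgA].
  by exists h; rewrite ?mulgA.
pose act k y := sval (cid (act_ex k y)).
have actE k y : F (act k y) = [set k^-1 * z | z in F y].
  exact: (svalP (cid (act_ex k y))).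
have act_inj k : injective (act k).
  move=> y y' E; apply: F_inj; have := congr1 F E; rewrite !actE => E'.
  apply/seteqP; split=> z zF.
    have : [set k^-1 * z | z in F y] (k^-1 * z) by exists z.
    by rewrite E' => -[z' z'F /mulgI <-].
  have : [set k^-1 * z | z in F y'] (k^-1 * z) by exists z.
  by rewrite -E' => -[z' z'F /mulgI <-].
pose rho k : {perm X} := perm (@act_inj k).
have rhoE k y : F (rho k y) = [set k^-1 * z | z in F y] by rewrite permE actE.
have rhoM k k' : rho (k * k') = rho k * rho k'.
  apply/permP => y; apply: F_inj; rewrite permM !rhoE.
  apply/seteqP; split=> [_ [z zF <-]|_ [_ [z zF <-] <-]].
    by exists (k^-1 * z); [exists z | rewrite invMg mulgA].
  by exists z; rewrite // invMg mulgA.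
have rho1 : rho 1 = 1 by apply: (mulgI (rho 1)); rewrite -rhoM !mulg1.
pose l : labelling m {perm X} :=
  fun h => [ffun i => rho (coiota (loop h (val [:: (i, true)])))].
(* Loops multiply along a walk by [loopM], so the labels telescope to the loop of the whole word. *)
have evalE h w : eval c l h w = rho (coiota (loop h (val w))).
  elim: w h => [|[i b] w IHw] h /=.
    rewrite word_value_nil /loop deg1 GRing.addr0 mulg1 mulgV.
    by rewrite -(multiplicative1 iota) iotaK.
  rewrite IHw -[_ :: w]cat1s word_value_cat loopM coiotaM ?deg_loop // rhoM.
  congr (_ * rho (coiota (loop _ _))); last first.
    by rewrite deg_word_value /= GRing.addr0.
  rewrite /letter_eval /=; case: b; first by rewrite ffunE.
  rewrite ffunE; apply: (mulgI (rho (coiota (loop (h - c i)%R (val [:: (i, true)]))))).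
  rewrite mulgV -rhoM -coiotaM ?deg_loop //.
  have /= := loopM (h - c i)%R (val [:: (i, true)]) (val [:: (i, false)]).
  have -> : (h - c i + deg (val [:: (i, true)]))%R = h by exact: GRing.subrK.
  move=> <-.
  rewrite (word_value_inv [:: (i, true)] : val [:: (i, false)] = _) mulgV.
  by rewrite /loop deg1 GRing.addr0 mulg1 mulgV -(multiplicative1 iota) iotaK rho1.
(* The relators meet this condition: [wx] leads from [lift h] to [lift (h + 1)], and the others have
   value 1. *)
have loop1 h g : lift h * g = lift (h + deg g)%R -> rho (coiota (loop h g)) = 1.
  by rewrite /loop => ->; rewrite mulgV -(multiplicative1 iota) iotaK rho1.
have lF : flat l.
  move=> h w; rewrite in_cons evalE => /orP[/eqP->|/mapP[a aS ->]].
    by apply: loop1; rewrite -liftS wx_deg.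
  rewrite val_repr f_normal_closure; last by apply: normal_closure_sub; apply/RE.
  by apply: loop1; rewrite deg1 GRing.addr0 mulg1.
have monE k : monodromy l k = rho k.
  rewrite /monodromy /transport evalE word_ofK /loop deg_iota lift0 invg1 mul1g mulg1.
  by rewrite iotaK.
(* The base point is the coset of 1, whose stabilizer is [H]. *)
have [p pH] := coset_F 1; exists l, p.
have lcoset1 : lcoset 1 = H.
  by apply/seteqP; split=> z; rewrite mem_lcoset invg1 mul1g.
split; [split=> // B /set0Pn[y yB] lB | apply/seteqP; split=> k].
- apply/setP => y'; rewrite finset.in_setT.
  have [[a Fa] [b Fb]] := (F_coset y, F_coset y').
  suff -> : y' = monodromy l (a * b^-1) y by apply: stable_monodromy.
  apply: F_inj; rewrite monE rhoE Fa Fb; apply/seteqP; split=> z.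
    move=> /mem_lcoset bz; exists (a * (b^-1 * z)); first by exists (b^-1 * z).
    by rewrite invMg invgK -!mulgA mulKg mulKVg.
  move=> [_ [h Hh <-] <-]; exists h => //.
  by rewrite invMg invgK -!mulgA mulKg.
- move=> kH; rewrite /monodromy_stabilizer /= monE; apply: F_inj.
  rewrite rhoE pH lcoset1; apply/seteqP; split=> z.
    by move=> [h Hh <-]; apply: HM => //; apply: HV1.
  by move=> Hz; exists (k * z); [apply: HM | rewrite mulKg].
- rewrite /monodromy_stabilizer /= monE => /(congr1 F).
  rewrite rhoE pH lcoset1 => E.
  have : H k^-1 by rewrite -E; exists 1; rewrite ?mulg1.
  by move/HV1; rewrite invgK.
Qed.

(** Stabilizers map pairs of a transitive labelling and a base point onto the subgroups of index
    [#|X|], and the fibers over a fixed base point are countable. *)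
Lemma subgroups_of_index_dichotomy : X ->
    finite_set transitive_flat \/ ~ countable transitive_flat ->
  finite_set (subgroups_of_index K #|X|) \/ ~ countable (subgroups_of_index K #|X|).
Proof.
move=> p [fin|unc]; [left|right].
  have := finite_image (fun lp => monodromy_stabilizer lp.1 lp.2)
    (finite_setX fin (@finite_finset X [set: X])).
  apply: sub_finite_set => H /subgroup_monodromy[l [q [lT ->]]].
  by exists (l, q).
apply: contra_not unc => cnt.
have -> : transitive_flat = \bigcup_(H in subgroups_of_index K #|X|)
    [set l | transitive_flat l /\ monodromy_stabilizer l p = H].
  apply/seteqP; split=> [l lT|l [H _ []] //].
  by exists (monodromy_stabilizer l p) => //; apply: monodromy_stabilizer_index.
apply: bigcup_countable => // H _; exact: countable_monodromy_fiber.
Qed.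

End Action.

End Correspondence.

Theorem theorem3p4 (K : groupType) (hK : fp_Z_group K)
    (n : nat) (hn : n \in [:: 2; 3; 4]) :
  finite_set (subgroups_of_index K n) \/ ~ countable (subgroups_of_index K n).
Proof.
case: hK => G [chi [iota [[m [R [f [/finite_seqP[s sE] f_surj f_ker]]]]]]].
move=> chi_surj iota_inj iota_range.
have [g g1] : exists g, deg chi g = 1%R.
  have : range chi (1%R : int) by rewrite chi_surj.
  by case=> g _ g1; exists g.
have [wx wxg] := word_value_surj f_surj g.
have wx_deg : deg chi (word_value f wx) = 1%R by rewrite wxg.
have RE a : R a <-> a \in s by rewrite sE.
have dichotomy X := subgroups_of_index_dichotomy f_surj f_ker iota_inj iota_range
  RE wx_deg (X := X).
move: hn; rewrite !inE => /or3P[] /eqP->.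
- by have := dichotomy _ true (transitive_flat2 _ _); rewrite card_bool.
- by have := dichotomy _ None (transitive_flat3 _ _); rewrite card_option card_bool.
- by have := dichotomy _ origin (transitive_flat4 _ _); rewrite card_prod card_bool.
Qed.
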